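(* Let $n\ge 2$ be a fixed integer. For every positive integer $T\ge 2$ there is a set $\mathcal{E}_T$ of primes $p\le T$, depending only on $n$ and $T$, with $\#\mathcal{E}_T=o(T/\log T)$ as $T\to\infty$, such that the following holds. For every $\mathbf{e}=(e_1,\ldots,e_n)\in\mathbb{Z}^n$ with $e_1\cdots e_n\ne 0$ and every $\varepsilon>0$ there is a constant $C=C(n,\mathbf{e},\varepsilon)>0$ such that, for every sufficiently large $T$ and every prime $p\le T$ with $p\notin\mathcal{E}_T$, for all integers $h$ with $3\le h\le p$, all integers $k_1,\ldots,k_n$ with corresponding cube $\mathcal{B}=[k_1+1,k_1+h]\times\cdots\times[k_n+1,k_n+h]$, all complex-valued weights $\boldsymbol{\rho}=(\rho_1,\ldots,\rho_n)$ with $|\rho_j(x)|\le 1$ for all $x\in\mathbb{R}$ and $j=1,\ldots,n$, all nontrivial multiplicative characters $\chi$ modulo $p$, and all integers $\lambda$ with $\gcd(\lambda,p)=1$, we have $$ |T_p(\lambda,\chi,\boldsymbol{\rho},\mathbf{e};\mathcal{B})|\le C\left(h^{n/2}p^{1/2}+h^{n/2+\lceil n/2\rceil/2-1/4}\,p^{1/4}+h^{n-1/2}\right)h^{\varepsilon}. $$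
   Context: The sum is $$ T_p(\lambda,\chi,\boldsymbol{\rho},\mathbf{e};\mathcal{B})=\sum_{\substack{(x_1,\ldots,x_n)\in\mathcal{B}\\ x_1\cdots x_n\not\equiv 0 \pmod p}}\rho_1(x_1)\cdots\rho_n(x_n)\,\chi(x_1^{e_1}\cdots x_n^{e_n}+\lambda), $$ where the summation is over integer vectors $(x_1,\ldots,x_n)$ in $\mathcal{B}$, for a negative exponent $e$ the power $x^e$ is computed with the inverse of $x$ modulo $p$ (so $x_1^{e_1}\cdots x_n^{e_n}+\lambda$ is a residue class modulo $p$), and $\chi(0)=0$. *)

(* Defs.v *)
From HB Require Import structures.
From mathcomp Require Import all_boot all_order all_algebra.
From mathcomp Require Import finmap.
From mathcomp Require Import complex.
From mathcomp Require Import all_classical all_reals all_analysis.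

Set Implicit Arguments.
Unset Strict Implicit.
Unset Printing Implicit Defensive.

Import Order.TTheory GRing.Theory Num.Theory.
Import numFieldNormedType.Exports.

Local Open Scope classical_set_scope.
Local Open Scope ring_scope.
Local Open Scope complex_scope.

Definition cube (n : nat) (k : 'I_n -> int) (h : nat) : set {ffun 'I_n -> int} :=
  [set x | forall j, k j + 1 <= x j <= k j + h%:Z].

(* [\sum_(x \in A)] over a classical set is 0 when the support is infinite; by
   this lemma that convention plays no role for sums over cubes. *)
Lemma finite_cube (n : nat) (k : 'I_n -> int) (h : nat) :
  finite_set (cube k h).
Proof.
pose f (i : {ffun 'I_n -> 'I_h.+1}) : {ffun 'I_n -> int} :=
  [ffun j => k j + (i j)%:Z].
apply: (@sub_finite_set _ _ (f @` [set: {ffun 'I_n -> 'I_h.+1}])).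
  move=> x xB; exists [ffun j => inord `|x j - k j|%N] => //.
  apply/ffunP => j; rewrite !ffunE; have /andP[lo hi] := xB j.
  have d0 : 0 <= x j - k j.
    by rewrite subr_ge0 (le_trans _ lo)// lerDl.
  have dh : (`|x j - k j| < h.+1)%N.
    by rewrite ltnS -lez_nat gez0_abs// lerBlDl.
  by rewrite inordK// gez0_abs// addrCA subrr addr0.
exact/finite_image/finite_finset.
Qed.

(* Characters take values on 'F_p, which is Z/pZ for p prime. *)
Definition mul_char (R : realType) (p : nat) (chi : 'F_p -> R[i]) : Prop :=
  GRing.monoid_morphism chi /\ chi 0 = 0.

Definition nontrivial_char (R : realType) (p : nat) (chi : 'F_p -> R[i]) : Prop :=
  exists2 x : 'F_p, x != 0 & chi x != 1.

(* The power [^] takes an exponent in int and uses the inverse of 'F_p when that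
   exponent is negative. *)
Definition charsum (R : realType) (p n : nat) (lambda : int)
    (chi : 'F_p -> R[i]) (rho : 'I_n -> R -> R[i]) (e : 'I_n -> int)
    (B : set {ffun 'I_n -> int}) : R[i] :=
  \sum_(x \in [set x | B x /\ ~~ (p%:Z %| \prod_(j < n) x j)%Z])
    (\prod_(j < n) rho j (x j)%:~R) *
    chi (\prod_(j < n) ((x j)%:~R : 'F_p) ^ e j + lambda%:~R).

(* Main.v *)
From mathcomp Require Import all_boot all_order all_algebra.
From mathcomp Require Import all_fingroup all_field all_character.
From mathcomp Require Import finmap.
From mathcomp Require Import complex.
From mathcomp Require Import all_classical all_reals all_analysis.
From mathcomp Require Import zify ring lra.
Require Import Defs.

(* Split the n variables into groups of m = floor(n/2) and r = ceil(n/2). The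
   substitution v = lambda / w turns the sum into a bilinear form in chi(u
     + w), whose Gram matrix is p I - J, so that |S|^2 <= p J_1 J_2, where
   J_i counts the coincidences of the monomials in the i-th group. By duality
   and Hoelder, J_i reduces to counting the solutions of
   (s + x_1)...(s + x_m) = (s + y_1)...(s + y_m) in F_p, and, after removing
   common factors, those with no x_i equal to a y_l.
   For fixed h such a solution is a root s mod p of the nonzero polynomial
   P = prod (X + x_i) - prod (X + y_i). If s has M solutions, then the h
   translates of s have at least M each in a doubled interval. Two polynomials
   with a common root mod p have a resultant divisible by p, and a nonzero
   resultant has O(log h) prime divisors; this bounds the sum of h M^2 over all
   primes for which M is large. Pairs with zero resultant are negligible: they
   share an algebraic root, whose primitive minimal polynomial Q satisfies
   prod Q(-x_i) = prod Q(-y_i) <> 0, so the divisor bound applies to the Q(-y_i).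
   Summing over dyadic h gives o(T / log T) exceptional primes. *)

Set Implicit Arguments.
Unset Strict Implicit.
Unset Printing Implicit Defensive.

Import Order.TTheory GRing.Theory Num.Theory.
Import numFieldNormedType.Exports.

Local Open Scope ring_scope.

(** * The divisor function *)

Section Divisors.
Local Open Scope nat_scope.

(** Every divisor d of a b is gcd(d, a) times a cofactor; the cofactor divides b because it is
    coprime to a / gcd(d, a). *)
Lemma size_divisorsM a b : 0 < a -> 0 < b ->
  size (divisors (a * b)) <= size (divisors a) * size (divisors b).
Proof.
move=> a0 b0; rewrite -(size_allpairs (fun x y => x * y)).
apply: uniq_leq_size (divisors_uniq _) _ => d.
rewrite -dvdn_divisors ?muln_gt0 ?a0// => dab.
have d0 : 0 < d by apply: dvdn_gt0 dab; rewrite muln_gt0 a0.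
have g0 : 0 < gcdn d a by rewrite gcdn_gt0 d0.
apply/allpairsP; exists (gcdn d a, d %/ gcdn d a) => /=.
rewrite -!dvdn_divisors// dvdn_gcdr; split=> //; last first.
  by rewrite mulnC divnK ?dvdn_gcdl.
have co : coprime (d %/ gcdn d a) (a %/ gcdn d a).
  rewrite /coprime -(eqn_pmul2r g0) mul1n muln_gcdl.
  by rewrite !divnK ?dvdn_gcdl ?dvdn_gcdr.
rewrite -(Gauss_dvdr _ co) -(@dvdn_pmul2r (gcdn d a))//.
by rewrite divnK ?dvdn_gcdl// mulnAC divnK ?dvdn_gcdr.
Qed.

Lemma size_divisors_pfactor p a : prime p -> size (divisors (p ^ a)) <= a.+1.
Proof.
move=> pp; have <- : size [seq p ^ i | i <- iota 0 a.+1] = a.+1 by rewrite size_map size_iota.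
apply: uniq_leq_size (divisors_uniq _) _ => d.
rewrite -dvdn_divisors ?expn_gt0 ?prime_gt0// => /(dvdn_pfactor _ _ pp)[m ma ->].
by apply: map_f; rewrite mem_iota.
Qed.

(** With q = floor(a / k), a + 1 <= k (q + 1) <= k 2^q; the k-th power of this gives C = k^k. *)
Lemma poly_le_exp2 k : exists C, forall a, a.+1 ^ k <= C * 2 ^ a.
Proof.
have [->|k0] := posnP k; first by exists 1 => a; rewrite expn0 mul1n expn_gt0.
exists (k ^ k) => a; have a1 : a.+1 <= k * 2 ^ (a %/ k).
  apply: (@leq_trans (k * (a %/ k).+1)); first by rewrite mulnC ltn_ceil.
  by rewrite leq_mul2l ltn_expl ?orbT.
apply: (@leq_trans ((k * 2 ^ (a %/ k)) ^ k)); first by rewrite leq_exp2r.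
by rewrite expnMn -expnM leq_mul2l leq_exp2l// leq_trunc_div orbT.
Qed.

(** A prime power p^a with p >= 2^k contributes (a + 1)^k <= 2^(k a) <= p^a, so large primes cost no
    constant. The induction strips the smallest prime factor of m. *)
Lemma divisors_pow_rough k m : 0 < m ->
  (forall q, prime q -> q %| m -> 2 ^ k <= q) -> size (divisors m) ^ k <= m.
Proof.
have [N] := ubnP m; elim: N m => // N IH m mN m0 rough.
have [m1|m1] := leqP m 1.
  by have -> : m = 1 by [lia]; rewrite [size _]/= exp1n.
have pp := pdiv_prime m1; have := pfactor_coprime pp m0.
move: (pdiv_dvd m) (pp); set p := pdiv m => pm {}pp [m' cop Em].
set a := logn p m in Em; have a0 : 0 < a by rewrite logn_gt0 mem_primes pp m0.
have p1 := prime_gt1 pp; have pa1 : 1 < p ^ a by rewrite -(exp1n a) ltn_exp2r.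
have m'0 : 0 < m' by case: (m') Em m0 => // ->.
have m'm : m' < m by rewrite Em ltn_Pmulr.
have {}IH : size (divisors m') ^ k <= m'.
  apply: IH => //; first by apply: leq_trans m'm _.
  by move=> q qp qm'; apply: rough => //; rewrite Em dvdn_mulr.
rewrite {2}Em Em (leq_trans (_ : _ <= (size (divisors m') * a.+1) ^ k))//.
  have [->//|k0] := posnP k; rewrite leq_exp2r//.
  apply: leq_trans (size_divisorsM _ _) _; rewrite // ?expn_gt0 ?prime_gt0//.
  by apply: leq_mul => //; exact: size_divisors_pfactor.
rewrite expnMn leq_mul//.
have [->|k0] := posnP k; first by rewrite expn0 ltnW.
apply: (@leq_trans ((2 ^ a) ^ k)); first by rewrite leq_exp2r// ltn_expl.
by rewrite -expnM mulnC expnM leq_exp2r// rough.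
Qed.

(** Induction on B: each prime below B multiplies the constant by a factor depending only on k,
    since (a + 1)^k = O(2^a). *)
Lemma divisors_pow_smooth k B : exists2 C, 0 < C & forall m, 0 < m ->
  (forall q, prime q -> q %| m -> q < B) -> size (divisors m) ^ k <= C * m.
Proof.
elim: B => [|B [C C0 IH]].
  exists 1 => // m m0 sm; have [m1|m1] := leqP m 1.
    by have -> : m = 1 by [lia]; rewrite [size _]/= exp1n.
  by have := sm _ (pdiv_prime m1) (pdiv_dvd m).
have [C' C'P] := poly_le_exp2 k.
have [pB|npB] := boolP (prime B); last first.
  exists C => // m m0 sm; apply: IH => // q qp qm.
  by have := sm _ qp qm; rewrite ltnS leq_eqVlt => /predU1P[E|//]; rewrite -E qp in npB.
exists (C * C'.+1); first by rewrite muln_gt0 C0.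
move=> m m0 sm; have [m' cop Em] := pfactor_coprime pB m0.
set a := logn B m in Em.
have m'0 : 0 < m' by case: (m') Em m0 => // ->.
have {}IH : size (divisors m') ^ k <= C * m'.
  apply: IH => // q qp qm'; have := sm q qp; rewrite Em dvdn_mulr// => /(_ isT).
  rewrite ltnS leq_eqVlt => /predU1P[E|//]; move: cop; rewrite -E.
  by rewrite prime_coprime// qm'.
rewrite {2}Em Em (leq_trans (_ : _ <= (size (divisors m') * a.+1) ^ k))//.
  have [->//|k0] := posnP k; rewrite leq_exp2r//.
  apply: leq_trans (size_divisorsM _ _) _; rewrite // ?expn_gt0 ?prime_gt0//.
  by apply: leq_mul => //; exact: size_divisors_pfactor.
rewrite expnMn mulnACA leq_mul//.
apply: leq_trans (C'P a) _; apply: leq_mul => //.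
have [->//|a0] := posnP a; rewrite leq_exp2r//.
exact: prime_gt1.
Qed.

(** This is the divisor bound d(m) = O(m^(1/k)) without roots. It follows by splitting m into its
    parts with primes below and from 2^k on. *)
Lemma divisors_pow_bound k : exists2 C, 0 < C & forall m, 0 < m ->
  size (divisors m) ^ k <= C * m.
Proof.
have [C C0 CP] := divisors_pow_smooth k (2 ^ k).
exists C => // m m0; pose pi : nat_pred := [pred q | q < 2 ^ k].
rewrite -(partnC pi m0).
rewrite (leq_trans (_ : _ <= (size (divisors m`_pi) * size (divisors m`_pi^')) ^ k))//.
  have [->//|k0] := posnP k; rewrite leq_exp2r//.
  by apply: size_divisorsM; rewrite part_gt0.
rewrite expnMn mulnA leq_mul//.
  apply: CP; first exact: part_gt0.
  by move=> q qp qm; have /pnatP := part_pnat pi m; apply=> //; rewrite part_gt0.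
apply: divisors_pow_rough; first exact: part_gt0.
move=> q qp qm; have /pnatP := part_pnat pi^' m.
by rewrite part_gt0 => /(_ isT q qp qm); rewrite !inE -leqNgt.
Qed.

End Divisors.

(** * Differences of products of linear polynomials *)

(** This is prod (X + x_i), written with X - (- x_i) so that results on products of monic linear
    factors apply. *)
Definition shift_prod (A : comNzRingType) (j L : nat) (x : {ffun 'I_j -> 'I_L}) : {poly A} :=
  \prod_i ('X - (- (x i)%:R)%:P).

Definition diff_poly (A : comNzRingType) (j L : nat)
    (z : {ffun 'I_j -> 'I_L} * {ffun 'I_j -> 'I_L}) : {poly A} :=
  shift_prod A z.1 - shift_prod A z.2.

Section Polynomials.
Variables (j L : nat).
Notation V := {ffun 'I_j -> 'I_L}.
Implicit Types (x y : V) (z : V * V).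

Lemma map_shift_prod (A B : comNzRingType) (f : {rmorphism A -> B}) x :
  map_poly f (shift_prod A x) = shift_prod B x.
Proof.
rewrite /shift_prod rmorph_prod; apply: eq_bigr => i _.
by rewrite rmorphB /= map_polyX map_polyC /= rmorphN rmorph_nat.
Qed.

Lemma map_diff_poly (A B : comNzRingType) (f : {rmorphism A -> B}) z :
  map_poly f (diff_poly A z) = diff_poly B z.
Proof. by rewrite rmorphB /= !map_shift_prod. Qed.

Lemma horner_shift_prod (A : comNzRingType) x (r : A) :
  (shift_prod A x).[r] = \prod_i (r + (x i)%:R).
Proof.
by rewrite horner_prod; apply: eq_bigr => i _; rewrite !hornerE opprK.
Qed.

Lemma size_shift_prod (A : comNzRingType) x : size (shift_prod A x) = j.+1.
Proof. by rewrite size_prod_XsubC /index_enum -enumT size_enum_ord. Qed.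

Lemma size_diff_poly (A : comNzRingType) z : (size (diff_poly A z) <= j.+1)%N.
Proof.
by rewrite (leq_trans (size_polyD _ _))// size_polyN !size_shift_prod maxnn.
Qed.

Lemma root_diff_poly (A : comNzRingType) z (r : A) :
  root (diff_poly A z) r = (\prod_i (r + (z.1 i)%:R) == \prod_i (r + (z.2 i)%:R)).
Proof. by rewrite /root hornerD hornerN !horner_shift_prod subr_eq0. Qed.

(** At - x_0 the first product vanishes, and the second does not because no y_l equals x_0. *)
Lemma diff_poly_neq0 (A : idomainType) z : (0 < j)%N ->
  (forall i l, (z.1 i)%:R != (z.2 l)%:R :> A) -> diff_poly A z != 0.
Proof.
move=> j0 dz; apply/eqP => z0; pose i0 := Ordinal j0.
have : root (diff_poly A z) (- (z.1 i0)%:R) by rewrite z0 root0.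
rewrite root_diff_poly (bigD1 i0)//= addNr mul0r eq_sym.
move/prodf_eq0 => [l _]; rewrite addrC subr_eq0 eq_sym.
exact/negP/dz.
Qed.

Lemma coef_shift_prod_ge0 x k : 0 <= (shift_prod int x)`_k.
Proof.
rewrite /shift_prod; elim/big_rec: _ k => [|i p _ IH] k; first by rewrite coef1; case: eqP.
rewrite polyCN opprK mulrDl coefD coefXM coefCM addr_ge0 ?mulr_ge0//.
by case: eqP.
Qed.

(** As all coefficients are nonnegative, each is at most the value at 1, which is prod (1 + x_i) <=
    L^j. *)
Lemma coef_shift_prod_le x k : (shift_prod int x)`_k <= (L ^ j)%:R.
Proof.
apply: (@le_trans _ _ (shift_prod int x).[1]); last first.
  rewrite horner_shift_prod natrX -[X in _ <= _ ^+ X]card_ord -prodr_const.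
  apply: ler_prod => i _; rewrite addr_ge0//=.
  by rewrite -[1]/(1%:R) -natrD ler_nat add1n ltn_ord.
rewrite horner_coef; have [ks|ks] := ltnP k (size (shift_prod int x)); last first.
  rewrite nth_default//; apply: sumr_ge0 => i _.
  by rewrite expr1n mulr1 coef_shift_prod_ge0.
rewrite (bigD1 (Ordinal ks))//= expr1n mulr1 lerDl; apply: sumr_ge0 => i _.
by rewrite expr1n mulr1 coef_shift_prod_ge0.
Qed.

Lemma coef_diff_poly z k : `|(diff_poly int z)`_k| <= (L ^ j)%:R.
Proof.
rewrite coefD coefN; have [] := (coef_shift_prod_le z.1 k, coef_shift_prod_le z.2 k).
have [] := (coef_shift_prod_ge0 z.1 k, coef_shift_prod_ge0 z.2 k).
move: (_`_k) (_`_k) (_%:R) => a b c a0 b0 ac bc.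
by rewrite ler_norml; apply/andP; split; lra.
Qed.

End Polynomials.

(** * Bounds for resultants, and integral minimal polynomials *)

Lemma det_bound (n : nat) (M : 'M[int]_n) (c : nat) :
  (forall a b, `|M a b| <= c%:R) -> `|\det M| <= (n`! * c ^ n)%:R.
Proof.
move=> Mc; rewrite (le_trans (ler_norm_sum _ _ _))//.
apply: (@le_trans _ _ (\sum_(s : {perm 'I_n}) (c ^ n)%:R)); last first.
  by rewrite sumr_const card_Sn -mulrnA mulnC.
apply: ler_sum => s _; rewrite normrM normrX normrN1 expr1n mul1r normr_prod.
rewrite natrX -[X in _ <= _ ^+ X]card_ord -prodr_const.
by apply: ler_prod => i _; rewrite normr_ge0 Mc.
Qed.

(** The Sylvester matrix has order at most 2 d, and its entries are coefficients of p and q or 0. *)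
Lemma resultant_bound (p q : {poly int}) (c d : nat) : (0 < d)%N -> (0 < c)%N ->
  (size p <= d.+1)%N -> (size q <= d.+1)%N ->
  (forall k, `|p`_k| <= c%:R) -> (forall k, `|q`_k| <= c%:R) ->
  `|resultant p q| <= ((2 * d) `! * c ^ (2 * d))%:R.
Proof.
move=> d0 c0 sp sq pc qc.
have dd : ((size q).-1 + (size p).-1 <= 2 * d)%N by lia.
rewrite (le_trans (@det_bound _ _ c _))//; last first.
  by rewrite ler_nat leq_mul ?leq_pexp2l ?fact_geq// leq_fact.
move=> a b; rewrite Sylvester_mxE; case: (fintype.split a) => k.
  by case: leqP => _; rewrite ?mulr1n// mulr0n normr0.
by case: leqP => _; rewrite ?mulr1n// mulr0n normr0.
Qed.

Lemma count_prime_divisors (s : seq nat) (N : nat) : (0 < N)%N -> uniq s ->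
  (forall q, q \in s -> prime q /\ (q %| N)%N) -> (2 ^ size s <= N)%N.
Proof.
elim: s N => [|q s IH] N N0; first by rewrite expn0.
move=> /= /andP[qs us] sP; have [pq qN] := sP q (mem_head _ _).
have q0 := prime_gt0 pq.
rewrite -(divnK qN) expnS mulnC leq_mul ?prime_gt1//.
have Nq : (0 < N %/ q)%N by rewrite divn_gt0 ?(dvdn_leq N0 qN).
apply: (IH _ Nq us) => r rs.
have [|pr rN] := sP r; first by rewrite in_cons rs orbT.
split=> //; move: rN; rewrite -{1}(divnK qN) Gauss_dvdl => [//|].
rewrite prime_coprime// dvdn_prime2//; apply: contraNneq qs => <-.
exact: rs.
Qed.

Local Notation pZtoC := (map_poly (intr : int -> algC)).

(** The leading coefficient is a nonzero integer, so for |a| > 1 isolating the leading term gives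
    |a|^(m+1) <= c d |a|^m. *)
Lemma root_bound (p : {poly int}) (c d : nat) (a : algC) : p != 0 -> (0 < c)%N -> (0 < d)%N ->
  (size p <= d.+1)%N -> (forall k, `|p`_k| <= c%:R) -> root (pZtoC p) a ->
  `|a| <= (c * d)%:R.
Proof.
move=> p0 c0 d0 sp pc ra; have cd1 : 1 <= (c * d)%:R :> algC.
  by rewrite ler1n muln_gt0 c0.
have [a1|a1] := real_leP (normr_real a) (real1 _); first exact: le_trans a1 cd1.
have sP : size (pZtoC p) = size p by rewrite size_map_inj_poly//; exact: intr_inj.
case Em : (size p) => [|[|m]].
- by move/eqP: Em; rewrite size_poly_eq0 (negPf p0).
- have [b b0 pb] := size_poly1P p (introT eqP Em).
  by move: ra; rewrite pb map_polyC rootC /= intr_eq0 (negPf b0).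
have lc1 : 1 <= `|(p`_m.+1)%:~R| :> algC.
  rewrite -intr_norm ler1z -gtz0_ge1 normr_gt0.
  by have := p0; rewrite -lead_coef_eq0 lead_coefE Em.
move: ra; rewrite /root horner_coef sP Em big_ord_recr /= coef_map /= addrC addr_eq0.
move/eqP/(congr1 Num.norm); rewrite normrN normrM => E.
have {E} : `|a| ^+ m.+1 <= (c * d)%:R * `|a| ^+ m.
  rewrite -normrX (le_trans (ler_peMl (normr_ge0 _) lc1))// E.
  rewrite (le_trans (ler_norm_sum _ _ _))//.
  apply: (@le_trans _ _ (\sum_(i < m.+1) c%:R * `|a| ^+ m)).
    apply: ler_sum => i _; rewrite normrM normrX coef_map /= -intr_norm.
    apply: ler_pM; rewrite ?ler0z ?normr_ge0 ?exprn_ge0//.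
      by rewrite -[c%:R](rmorph_nat intr) ler_int.
    by apply: ler_weXn2l; rewrite ?(ltW a1)// -ltnS.
  rewrite sumr_const card_ord -mulrnAl -mulrnA ler_wpM2r ?exprn_ge0//.
  by rewrite ler_nat leq_mul2l -ltnS -Em sp orbT.
by rewrite exprS ler_pM2r// exprn_gt0// (lt_trans ltr01).
Qed.

(** By Gauss's lemma, the primitive integer multiple of the minimal polynomial of a divides within
    Z[X] every integer polynomial vanishing at a. An integral cofactor makes the leading coefficient
    of Q divide that of P. *)
Lemma int_minpoly (a : algC) (p : {poly int}) : p != 0 -> root (pZtoC p) a ->
  exists Q : {poly int}, [/\ root (pZtoC Q) a, Q != 0 &
    forall P : {poly int}, root (pZtoC P) a -> exists R, P = Q * R].
Proof.
move=> p0 ra; have [q [_ qm qP]] := minCpolyP a.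
have [Q0 [b b0 Eq]] := rat_poly_scale q.
have ratC (P : {poly int}) : map_poly ratr (map_poly (intr : int -> rat) P) = pZtoC P.
  by rewrite -map_poly_comp; apply: eq_map_poly => k /=; rewrite ratr_int.
have dvQ (P : {poly int}) : root (pZtoC P) a -> Q0 %| P.
  rewrite -ratC qP Eq dvdpZl ?invr_eq0 ?intr_eq0//.
  by rewrite dvdp_rat_int.
have Q00 : Q0 != 0.
  by apply: contraTneq (dvQ _ ra) => ->; rewrite dvd0p.
have rQ0 : root (pZtoC Q0) a.
  by rewrite -ratC qP Eq dvdpZl ?invr_eq0 ?intr_eq0// dvdpp.
exists (zprimitive Q0); split.
- move: rQ0; rewrite {1}(zpolyEprim Q0) map_polyZ rootZ// intr_eq0.
  by rewrite zcontents_eq0.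
- by rewrite zprimitive_eq0.
by move=> P /dvQ /dvdpP_int [R ->]; exists R.
Qed.

(* Up to lead_coef Q and signs both sides are the product over the roots b of Q
   of prod (b + x_i), resp. prod (b + y_i). *)
Lemma norm_prod_eq j L (Q R : {poly int}) (x y : {ffun 'I_j -> 'I_L}) :
  diff_poly int (x, y) = Q * R ->
  \prod_i Q.[- (x i)%:R] = \prod_i Q.[- (y i)%:R].
Proof.
move=> E; apply: (@intr_inj algC); rewrite !rmorph_prod /=.
have [r Er] := closed_field_poly_normal (pZtoC Q).
have QE (v : {ffun 'I_j -> 'I_L}) : \prod_i ((Q.[- (v i)%:R])%:~R : algC) =
    lead_coef (pZtoC Q) ^+ j * \prod_(b <- r) ((-1) ^+ j * \prod_i (b + (v i)%:R)).
  transitivity (\prod_i (lead_coef (pZtoC Q) * \prod_(b <- r) (- (b + (v i)%:R)))).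
    apply: eq_bigr => i _; rewrite -horner_map /= {1}Er hornerZ horner_prod.
    congr (_ * _); apply: eq_bigr => b _.
    by rewrite hornerXsubC rmorphN /= rmorph_nat opprD addrC.
  rewrite big_split /= prodr_const card_ord; congr (_ * _); rewrite exchange_big /=;
    apply: eq_bigr => b _.
  by rewrite prodrN card_ord.
rewrite !QE; congr (_ * _); apply: eq_big_seq => b br; congr (_ * _).
apply/eqP; have := @root_diff_poly j L algC (x, y) b => /= <-.
suff : root (pZtoC (diff_poly int (x, y))) b by rewrite map_diff_poly.
rewrite E rmorphM rootM; apply/orP; left; rewrite /= Er.
have [->|l0] := eqVneq (lead_coef (pZtoC Q)) 0; first by rewrite scale0r root0.
by rewrite rootZ// root_prod_XsubC br.
Qed.

(** The roots of Q are roots of p, hence at most c d in absolute value by [root_bound]. There are at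
    most d of them, and the leading coefficient of Q divides that of p. *)
Lemma value_bound (Q p R : {poly int}) (c d L v : nat) : p != 0 -> (0 < c)%N -> (0 < d)%N ->
  (size p <= d.+1)%N -> (forall k, `|p`_k| <= c%:R) -> p = Q * R -> (v < L)%N ->
  `|Q.[- v%:R]| <= (c * (L + c * d) ^ d)%:R.
Proof.
move=> p0 c0 d0 sp pc E vL.
have [Q0 R0] : Q != 0 /\ R != 0 by apply/andP; rewrite -negb_or -mulf_eq0 -E.
have sQ : (size Q <= d.+1)%N.
  by apply: leq_trans sp;
    rewrite E size_mul// -ltnS prednK ?addn_gt0 ?size_poly_gt0 ?Q0// -addn1 leq_add2l size_poly_gt0.
have lcQ : `|lead_coef Q| <= c%:R.
  rewrite (le_trans _ (pc (size p).-1))// -lead_coefE E lead_coefM normrM.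
  by rewrite ler_peMr// -gtz0_ge1 normr_gt0 lead_coef_eq0.
rewrite -(ler_int algC) intr_norm -horner_map /= rmorphN /= !rmorph_nat.
have [r Er] := closed_field_poly_normal (pZtoC Q).
have lQ : lead_coef (pZtoC Q) = (lead_coef Q)%:~R.
  by rewrite lead_coef_map_inj//; exact: intr_inj.
have sr : (size r <= d)%N.
  have : size (pZtoC Q) = size Q by rewrite size_map_inj_poly//; exact: intr_inj.
  rewrite Er size_scale ?size_prod_XsubC; first by move=> e; rewrite -ltnS e.
  by rewrite lQ intr_eq0 lead_coef_eq0.
rewrite Er hornerZ horner_prod normrM natrM lQ; apply: ler_pM => //.
  by rewrite -intr_norm -[c%:R](rmorph_nat intr) ler_int.
rewrite normr_prod natrX; apply: (@le_trans _ _ (\prod_(b <- r) (L + c * d)%:R)).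
  rewrite big_seq [X in _ <= X]big_seq; apply: ler_prod => b br; rewrite normr_ge0 hornerXsubC.
  rewrite -opprD normrN (le_trans (ler_normD _ _))// natrD lerD//.
    by rewrite normr_nat ler_nat ltnW.
  apply: root_bound p0 _ _ sp pc _ => //; rewrite E rmorphM rootM.
  apply/orP; left; rewrite /= Er rootZ ?root_prod_XsubC ?br//.
  by rewrite lQ intr_eq0 lead_coef_eq0.
rewrite big_const_seq count_predT iter_mulr_1.
by apply: ler_weXn2l; rewrite // ler1n (leq_trans _ (leq_addl _ _))// muln_gt0 c0.
Qed.

Definition disjoint_entries j L (z : {ffun 'I_j -> 'I_L} * {ffun 'I_j -> 'I_L}) : bool :=
  [forall i, forall l, z.1 i != z.2 l].

Lemma disjoint_entriesP j L (z : {ffun 'I_j -> 'I_L} * {ffun 'I_j -> 'I_L}) :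
  reflect (forall i l, z.1 i != z.2 l) (disjoint_entries z).
Proof. by apply: (iffP forallP) => H i; [apply/forallP|apply/forallP]. Qed.

Lemma count_values L d (Q : {poly int}) (c : int) : (1 < size Q <= d.+1)%N ->
  (#|[pred v : 'I_L | Q.[- (v : nat)%:R] == c]| <= d)%N.
Proof.
move=> /andP[s1 sd]; set A := [pred v | _].
have sQ : size (Q - c%:P) = size Q.
  by rewrite size_polyDl// size_polyN (leq_ltn_trans (size_polyC_leq1 _)).
have Q0 : Q - c%:P != 0 by rewrite -size_poly_eq0 sQ; case: (size Q) s1.
rewrite cardE -(size_map (fun v : 'I_L => - (v : nat)%:R : int)) -ltnS.
apply: leq_trans sd; rewrite -sQ; apply: max_poly_roots => //.
  apply/allP => _ /mapP[v vA ->]; rewrite mem_enum inE in vA.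
  by rewrite /root hornerD hornerN hornerC subr_eq0.
rewrite map_inj_uniq ?enum_uniq// => u v /oppr_inj/eqP.
by rewrite eqr_nat => /eqP/val_inj.
Qed.

(** Each divisor e of W allows the two values e and - e, and a nonconstant Q takes each of them at
    most d times. *)
Lemma count_divisor_values L d W D (Q : {poly int}) : (1 < size Q <= d.+1)%N ->
  (size (divisors W) <= D)%N ->
  (#|[pred v : 'I_L | `|Q.[- (v : nat)%:R]|%N \in divisors W]| <= 2 * d * D)%N.
Proof.
move=> sQ WD; rewrite -sum1_card.
apply: (@leq_trans (\sum_(v : 'I_L) \sum_(e <- divisors W)
   ((Q.[- (v : nat)%:R] == e%:Z) + (Q.[- (v : nat)%:R] == - e%:Z)))).
  rewrite big_mkcond; apply: leq_sum => v _; rewrite inE; case: ifP => // vW.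
  rewrite (big_rem _ vW) /= (leq_trans _ (leq_addr _ _))//.
  by move: Q.[_] => c; lia.
rewrite exchange_big /=; apply: (@leq_trans (\sum_(e <- divisors W) (2 * d))).
  apply: leq_sum => e _; rewrite big_split mul2n -addnn; apply: leq_add.
    by rewrite (leq_trans _ (count_values L e sQ))// -sum1_card [X in (_ <= X)%N]big_mkcond.
  by rewrite (leq_trans _ (count_values L (- e%:Z) sQ))// -sum1_card [X in (_
    <= X)%N]big_mkcond.
by rewrite big_const_seq count_predT iter_addn_0 leq_mul2l WD orbT.
Qed.

(** * Pairs of polynomials with zero resultant *)

Section CommonRoot.
Variables (j L B D : nat).
Notation V := {ffun 'I_j -> 'I_L}.
Hypothesis divD : forall m, (0 < m <= B ^ j)%N -> (size (divisors m) <= D)%N.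

(** For fixed x, the number W = |prod Q(-x_i)| is nonzero and equals |prod Q(-y_i)| by
    [norm_prod_eq]. Every Q(-y_i) thus divides W, which leaves at most 2 j D choices for each
    y_i. *)
Lemma count_partner (Q : {poly int}) (a : algC) (x : V) :
  (1 < size Q <= j.+1)%N ->
  (forall P : {poly int}, root (pZtoC P) a -> exists R, P = Q * R) ->
  (forall v, (v < L)%N -> `|Q.[- v%:R]| <= B%:R) ->
  (#|[pred y : V | disjoint_entries (x, y) && root (pZtoC (diff_poly int (x, y))) a]|
    <= (2 * j * D) ^ j)%N.
Proof.
move=> sQ Qdvd QB; set A := [pred y | _].
have [y0 y0A|A0] := pickP A; last by rewrite eq_card0.
(* If Q(-x_i) = 0, then -x_i is a root of the difference for the partner y0, so x_i is an entry of
   y0, against disjointness. *)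
have Qx i : Q.[- (x i : nat)%:R] != 0.
  move: y0A; rewrite inE => /andP[/disjoint_entriesP dxy /Qdvd[R E]].
  apply/eqP => Q0; have : root (diff_poly int (x, y0)) (- (x i)%:R).
    by rewrite E rootM /root Q0 eqxx.
  rewrite root_diff_poly /= (bigD1 i)//= addNr mul0r eq_sym => /prodf_eq0[l _].
  rewrite addrC subr_eq0 eqr_nat => /eqP/val_inj E1.
  by have := dxy i l; rewrite /= E1 eqxx.
pose W := absz (\prod_i Q.[- (x i : nat)%:R])%R.
have W0 : (0 < W)%N by rewrite absz_gt0; apply/prodf_neq0 => i _.
have WB : (W <= B ^ j)%N.
  rewrite -lez_nat abszE normr_prod -natz natrX -[X in _ <= _ ^+ X]card_ord -prodr_const.
  by apply: ler_prod => i _; rewrite normr_ge0 QB.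
pose Y := [pred v : 'I_L | `|Q.[- (v : nat)%:R]|%N \in divisors W].
have cY : (#|Y| <= 2 * j * D)%N.
  by apply: count_divisor_values => //; apply: divD; rewrite W0.
apply: (@leq_trans #|(ffun_on (mem Y) : pred V)|); last first.
  by rewrite card_ffun_on card_ord; case: (j) cY => // k cY; rewrite leq_exp2r.
apply: subset_leq_card; apply/fintype.subsetP => y; rewrite inE => /andP[_ /Qdvd[R E]].
apply/ffun_onP => i; rewrite inE -dvdn_divisors//.
by rewrite /W (norm_prod_eq E) (bigD1 i)//= abszM dvdn_mulr.
Qed.

(** A zero resultant forces a common algebraic root a. There are at most j roots a of the first
    polynomial, L^j choices of x, and then [count_partner] bounds the choices of y. *)
Lemma count_common_root (z : V * V) (c : nat) : (0 < j)%N -> (0 < c)%N ->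
  (forall k, `|(diff_poly int z)`_k| <= c%:R) -> (c * (L + c * j) ^ j <= B)%N ->
  diff_poly int z != 0 ->
  (#|[pred w : V * V | disjoint_entries w
    && (resultant (diff_poly int z) (diff_poly int w) == 0%R)]|
     <= j * (L ^ j * (2 * j * D) ^ j))%N.
Proof.
move=> j0 c0 zc cB z0; set P := diff_poly int z in zc z0 *.
have sP : (size P <= j.+1)%N by exact: size_diff_poly.
have [r Er] := closed_field_poly_normal (pZtoC P).
have lP : lead_coef (pZtoC P) != 0.
  by rewrite lead_coef_map_inj ?intr_eq0 ?lead_coef_eq0//; exact: intr_inj.
have sr : (size r <= j)%N.
  have : size (pZtoC P) = size P by rewrite size_map_inj_poly//; exact: intr_inj.
  by rewrite Er size_scale// size_prod_XsubC => e; rewrite -ltnS e.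
have rP a : (a \in r) = root (pZtoC P) a by rewrite Er rootZ// root_prod_XsubC.
rewrite -sum1_card big_mkcond.
apply: (@leq_trans (\sum_(w : V * V) \sum_(a <- r)
   (disjoint_entries w && root (pZtoC (diff_poly int w)) a))).
  apply: leq_sum => w _; rewrite inE; case: ifP => // /andP[-> rw0] /=.
  have [a ar aw] : exists2 a, a \in r & root (pZtoC (diff_poly int w)) a.
    move/eqP: rw0; move/eqP; rewrite resultant_eq0 => sg.
    have /closed_rootP[a] : size (pZtoC (gcdp P (diff_poly int w))) != 1%N.
      rewrite size_map_inj_poly//; last exact: intr_inj.
      by case: (size _) sg => [|[]].
    have dv (q : {poly int}) : gcdp P (diff_poly int w) %| q
      -> root (pZtoC (gcdp P (diff_poly int w))) a -> root (pZtoC q) a.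
      move=> /Pdiv.Idomain.dvdpP[[k t] /= k0 Eq] ga.
      have : root (pZtoC (k *: q)) a by rewrite Eq rmorphM rootM ga orbT.
      by rewrite map_polyZ rootZ// intr_eq0.
    move=> ga; exists a; first by rewrite rP dv ?dvdp_gcdl.
    by rewrite dv ?dvdp_gcdr.
  by rewrite (big_rem _ ar) /= aw.
rewrite exchange_big /=; apply: (@leq_trans (\sum_(a <- r) (L ^ j * (2 * j * D) ^ j)));
  last first.
  by rewrite big_const_seq count_predT iter_addn_0 mulnC leq_mul2r sr orbT.
rewrite big_seq [X in (_ <= X)%N]big_seq; apply: leq_sum => a ar.
have [Q [Qa Q0 Qdvd]] := int_minpoly z0 (etrans (esym (rP a)) ar).
have [R ER] := Qdvd _ (etrans (esym (rP a)) ar).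
have R0 : R != 0 by apply: contraNneq z0 => R0; rewrite -/P ER R0 mulr0.
have sQ : (1 < size Q <= j.+1)%N.
  apply/andP; split.
    rewrite ltn_neqAle eq_sym size_poly_gt0 Q0 andbT; apply/negP => /eqP sQ1.
    have [b b0 Qb] := size_poly1P Q (introT eqP sQ1).
    by move: Qa; rewrite Qb map_polyC rootC /= intr_eq0 (negPf b0).
  apply: leq_trans sP; rewrite ER size_mul// -ltnS prednK ?addn_gt0 ?size_poly_gt0 ?Q0//.
  by rewrite -addn1 leq_add2l size_poly_gt0.
have QB v : (v < L)%N -> `|Q.[- v%:R]| <= B%:R.
  move=> vL; rewrite (le_trans (value_bound z0 c0 j0 sP zc ER vL))//.
  by rewrite ler_nat.
rewrite -(pair_big xpredT xpredT (fun x y => (disjoint_entries (x, y)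
  && root (pZtoC (diff_poly int (x, y))) a : nat))) /=.
apply: (@leq_trans (\sum_(x : V) (2 * j * D) ^ j)); last first.
  by rewrite sum_nat_const card_ffun !card_ord.
apply: leq_sum => x _; rewrite (leq_trans _ (count_partner x sQ Qdvd QB))//.
by rewrite -sum1_card [X in (_ <= X)%N]big_mkcond; apply: leq_sum => y _; rewrite inE;
  case: (_ && _).
Qed.
End CommonRoot.

(** * Counting exceptional primes *)

(** Having s as a root of [diff_poly] is the equation prod (s + x_i) = prod (s + y_i) in F_p. *)
Definition disjoint_count (p j h : nat) (s : 'F_p) : nat :=
  #|[pred z : {ffun 'I_j -> 'I_h} * {ffun 'I_j -> 'I_h} |
      disjoint_entries z && root (diff_poly 'F_p z) s]|.

Definition res_pairs (p j L : nat) :=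
  [pred w : ({ffun 'I_j -> 'I_L} * {ffun 'I_j -> 'I_L}) *
            ({ffun 'I_j -> 'I_L} * {ffun 'I_j -> 'I_L}) |
     let R := resultant (diff_poly int w.1) (diff_poly int w.2) in
     (R != 0) && (p%:Z %| R)%Z].

Lemma card_sumb (T : finType) (A : {pred T}) : #|A| = (\sum_x (x \in A))%N.
Proof. by rewrite -sum1_card big_mkcond; apply: eq_bigr => x _; case: ifP. Qed.

Lemma Fp_nat_inj p (a b : nat) : prime p -> (a < p)%N -> (b < p)%N ->
  a%:R = b%:R :> 'F_p -> a = b.
Proof.
move=> pp ap bp /(congr1 val); rewrite /= !val_Fp_nat//.
by rewrite !modn_small.
Qed.

(** * Second moment over the translates of a residue *)

Section SecondMoment.
Variables (p j h L : nat).
Hypotheses (pp : prime p) (j0 : (0 < j)%N).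
Notation V := {ffun 'I_j -> 'I_L}.

(** The entries must differ modulo p and not only as integers, because L may exceed p; this keeps
    the difference polynomial nonzero over F_p. *)
Definition solution (r : 'F_p) (w : V * V) : bool :=
  [forall i, forall l, (w.1 i)%:R != (w.2 l)%:R :> 'F_p] && root (diff_poly 'F_p w) r.

Lemma solutionP r w : solution r w ->
  [/\ disjoint_entries w, diff_poly 'F_p w != 0 & root (diff_poly 'F_p w) r].
Proof.
case/andP => /forallP d rw; have d' i l : (w.1 i)%:R != (w.2 l)%:R :> 'F_p.
  by move/forallP: (d i).
split=> //; last exact: diff_poly_neq0.
by apply/disjoint_entriesP => i l; apply: contraNneq (d' i l) => ->.
Qed.

(** The resultant is an integral combination of the two polynomials; modulo p both vanish at r. *)
Lemma solution_dvd_resultant r w1 w2 : solution r w1 -> solution r w2 ->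
  (p%:Z %| resultant (diff_poly int w1) (diff_poly int w2))%Z.
Proof.
move=> s1 s2.
(* Nonconstancy is needed to write the resultant as such a combination: a polynomial that is nonzero
   modulo p and has a root there is not constant. *)
have sz w : solution r w -> (1 < size (diff_poly int w))%N.
  move=> /solutionP[_ w0 wr]; apply: (@leq_trans (size (diff_poly 'F_p w))).
    rewrite ltn_neqAle eq_sym size_poly_gt0 w0 andbT; apply/negP => /size_poly1P[b b0 E].
    by move: wr; rewrite E rootC (negPf b0).
  by rewrite -(map_diff_poly intr) size_poly.
have [[u v] _ /= E] := resultant_in_ideal (sz _ s1) (sz _ s2).
have pF : p \in [pchar 'F_p] by rewrite pchar_Fp.
rewrite (dvdz_pcharf pF).
have : root (map_poly (intr : int
  -> 'F_p) (resultant (diff_poly int w1) (diff_poly int w2))%:P) r.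
  rewrite E rmorphD !rmorphM /= !map_diff_poly /root hornerD !hornerM.
  have [_ _ /rootP ->] := solutionP s1; have [_ _ /rootP ->] := solutionP s2.
  by rewrite !mulr0 addr0.
by rewrite map_polyC rootC.
Qed.

Lemma count_solution_root (w : V * V) : (#|[pred r | solution r w]| <= j)%N.
Proof.
have [r rs|e] := pickP [pred r | solution r w]; last by rewrite eq_card0.
have [_ w0 _] := solutionP rs.
rewrite cardE -ltnS; apply: leq_trans (size_diff_poly 'F_p w).
apply: max_poly_roots w0 _ (enum_uniq _); apply/allP => t.
by rewrite mem_enum inE => /solutionP[].
Qed.

(** Adding t to all entries while replacing s by s - t leaves every factor s + x_i unchanged. *)
Lemma solution_shift (s : 'F_p) (t : nat) : (h <= p)%N -> (h + t <= L)%N ->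
  (disjoint_count j h s <= #|[pred w | solution (s - t%:R)%R w]|)%N.
Proof.
move=> hp htL; have lt (a : 'I_h) : (a + t < L)%N.
  by apply: leq_trans htL; rewrite ltn_add2r.
pose sh (x : {ffun 'I_j -> 'I_h}) : V := [ffun i => Ordinal (lt (x i))].
have shI : injective sh.
  move=> x y /ffunP E; apply/ffunP => i; have := E i; rewrite !ffunE => /(congr1 val)/=.
  by move/addIn => /val_inj.
pose f z := (sh z.1, sh z.2).
have fI : injective f by move=> [x y] [x' y'] [/shI-> /shI->].
rewrite /disjoint_count -(fintype.card_image fI); apply: subset_leq_card;
  apply/fintype.subsetP => _ /fintype.imageP[z zs ->].
move: zs; rewrite !inE => /andP[/disjoint_entriesP dz rz]; apply/andP; split.
  apply/forallP => i; apply/forallP => l; rewrite !ffunE /= !natrD.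
  apply: contra (dz i l) => /eqP/addIr E; apply/eqP/val_inj.
  by apply: (Fp_nat_inj pp) E; rewrite (leq_trans _ hp).
move: rz; rewrite !root_diff_poly /= => /eqP E; apply/eqP.
have e (x : {ffun 'I_j -> 'I_h}) :
    \prod_i (s - t%:R + (sh x i : nat)%:R) = \prod_i (s + (x i)%:R).
  by apply: eq_bigr => i _; rewrite ffunE /= natrD; ring.
by rewrite !e.
Qed.

(* Z0 bounds the number of partners w with zero resultant; as M >= 2 Z0 they
   account for at most half of the M^2 pairs over each translate of s. *)
Lemma second_moment (s : 'F_p) (Z0 : nat) : (h <= p)%N -> (h + h <= L)%N ->
  (forall w : V * V, diff_poly int w != 0 ->
    (#|[pred v : V * V | disjoint_entries v
      && (resultant (diff_poly int w) (diff_poly int v) == 0%R)]| <= Z0)%N) ->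
  (2 * Z0 <= disjoint_count j h s)%N ->
  (h * disjoint_count j h s ^ 2 <= 2 * j * #|res_pairs p j L|)%N.
Proof.
move=> hp hL resZ ZM; set M := disjoint_count j h s in ZM *.
pose P r := [pred w : (V * V) * (V * V) |
  [&& solution r w.1, solution r w.2 & resultant (diff_poly int w.1) (diff_poly int w.2) != 0]].
have Pr r : (2 * Z0 <= #|[pred w | solution r w]|)%N -> (#|[pred w | solution r w]| ^ 2
  <= 2 * #|P r|)%N.
  set N := #|_| => ZN.
  suff : (N ^ 2 <= #|P r| + N * Z0)%N by nia.
  rewrite -[(N ^ 2)%N]/(N * N)%N -cardX.
  have -> : #|[predX [pred w | solution r w] & [pred w | solution r w]]| =
     (#|P r| + #|[pred w : (V * V) * (V * V) | [&& solution r w.1, solution r w.2 &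
        resultant (diff_poly int w.1) (diff_poly int w.2) == 0%R]]|)%N.
    rewrite !card_sumb -big_split /=; apply: eq_bigr => -[w1 w2] _.
    rewrite !inE /=; case: (solution r w1) => //=; case: (solution r w2) => //=.
    by case: eqP.
  rewrite leq_add2l card_sumb.
  rewrite -(pair_big xpredT xpredT (fun w1 w2 => [&& solution r w1, solution r w2 &
     resultant (diff_poly int w1) (diff_poly int w2) == 0%R] : nat)) /=.
  rewrite /N card_sumb big_distrl /=; apply: leq_sum => w _; rewrite inE.
  have [sw|_] := boolP (solution r w); last by rewrite big1.
  have [_ w0 _] := solutionP sw; rewrite mul1n (leq_trans _ (resZ w _))//.
    rewrite card_sumb; apply: leq_sum => v _; rewrite inE /=.
    by have [/solutionP[-> _ _]|] := boolP (solution r v).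
  apply: contraNneq w0 => w0; have := map_diff_poly (intr : int -> 'F_p) w.
  by rewrite w0 rmorph0 => <-.
have Ms t : (t < h)%N -> (M ^ 2 <= 2 * #|P (s - t%:R)%R|)%N.
  move=> th; have MN : (M <= #|[pred w | solution (s - t%:R)%R w]|)%N.
    by apply: solution_shift => //; rewrite (leq_trans _ hL)// leq_add2l ltnW.
  rewrite (leq_trans _ (Pr _ _))// ?leq_exp2r//.
  exact: leq_trans MN.
(* The h translates s - t are distinct residues because h <= p, so the bounds [Ms] add up to a sum
   over all r. *)
apply: (@leq_trans (2 * \sum_(r : 'F_p) #|P r|)).
  rewrite big_distrr /=.
  have gI : injective (fun t : 'I_h => s - (t : nat)%:R : 'F_p).
    move=> a b /addrI/oppr_inj E; apply/val_inj; apply: (Fp_nat_inj pp) E.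
      by rewrite (leq_trans _ hp).
    by rewrite (leq_trans _ hp).
  rewrite -[X in (X * _ <= _)%N]card_ord -sum_nat_const.
  apply: (@leq_trans (\sum_(t < h) 2 * #|P (s - (t : nat)%:R)%R|)).
    by apply: leq_sum => t _; apply: Ms.
  rewrite -(big_map (fun t : 'I_h => s - (t : nat)%:R : 'F_p) xpredT (fun r : 'F_p
    => (2 * #|P r|)%N)) /=.
  rewrite big_uniq; last by rewrite map_inj_uniq ?index_enum_uniq.
  rewrite big_mkcond /=; apply: leq_sum => r _; by case: ifP.
rewrite -mulnA leq_mul2l /=.
under eq_bigr do rewrite card_sumb.
(* A pair w lies in [P r] for at most j residues r, all of them roots of its first polynomial, and
   only if p divides its nonzero resultant. *)
rewrite exchange_big card_sumb big_distrr /=.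
apply: leq_sum => w _; rewrite -(card_sumb [pred r | P r w]).
have [r|e] := pickP [pred r | P r w]; last first.
  by rewrite eq_card0 // => r; have := e r; rewrite !inE.
rewrite inE => /and3P[s1 s2 r0].
have -> : w \in res_pairs p j L by rewrite inE /= r0 (solution_dvd_resultant s1 s2).
rewrite muln1.
apply: leq_trans (count_solution_root w.1); apply: subset_leq_card.
by apply/fintype.subsetP => x; rewrite !inE => /and3P[].
Qed.
End SecondMoment.

(** * Counting bad primes at one dyadic scale *)

Lemma fact_le_exp2 d : (d `! <= 2 ^ (d ^ 2))%N.
Proof.
elim: d => // d IH; rewrite factS (leq_trans (leq_mul (ltn_expl d (ltnSn 1)) IH))//.
by rewrite -expnD leq_exp2l//; nia.
Qed.

(** In [resultant_bound] the factorial is at most 2^(4 j^2) and the coefficients contribute 2^(2 j^2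
    (i+1)), whence the constant 6 = 4 + 2. *)
Lemma resultant_diff_poly_bound i j (w1 w2 : {ffun 'I_j -> 'I_(2 ^ i.+1)} * {ffun 'I_j
  -> 'I_(2 ^ i.+1)}) :
  (0 < j)%N -> (absz (resultant (diff_poly int w1) (diff_poly int w2))
    <= 2 ^ (6 * j ^ 2 * i.+1))%N.
Proof.
move=> j0; rewrite -lez_nat abszE -natz.
have L0 : (0 < (2 ^ i.+1) ^ j)%N by rewrite !expn_gt0.
apply: le_trans (resultant_bound j0 L0 (size_diff_poly _ _) (size_diff_poly _ _)
  (coef_diff_poly _) (coef_diff_poly _)) _.
rewrite ler_nat (leq_trans (leq_mul (fact_le_exp2 _) (leqnn _)))//.
rewrite -!expnM -expnD leq_exp2l//; nia.
Qed.

(** After exchanging the sums, each of the L^(4j) pairs of pairs, with L = 2^(i+1), contributes the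
    number of primes in s dividing one nonzero resultant, at most the binary logarithm of its size
    bound. *)
Lemma sum_res_pairs (s : seq nat) i j : (0 < j)%N -> uniq s -> (forall p, p \in s
  -> prime p) ->
  (\sum_(p <- s) #|res_pairs p j (2 ^ i.+1)| <= 6 * j ^ 2 * i.+1 * ((2 ^ i.+1) ^ j) ^ 4)%N.
Proof.
move=> j0 us sp; under eq_bigr do rewrite card_sumb.
rewrite exchange_big /=.
have -> : (((2 ^ i.+1) ^ j) ^ 4)%N = #|{: ({ffun 'I_j -> 'I_(2 ^ i.+1)} * {ffun 'I_j
  -> 'I_(2 ^ i.+1)}) *
            ({ffun 'I_j -> 'I_(2 ^ i.+1)} * {ffun 'I_j -> 'I_(2 ^ i.+1)})}|.
  by rewrite !card_prod !card_ffun !card_ord; lia.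
rewrite mulnC -sum_nat_const; apply: leq_sum => w _.
set R := resultant (diff_poly int w.1) (diff_poly int w.2).
have [R0|R0] := eqVneq R 0.
  by rewrite big1// => p _; rewrite inE /= -/R R0 eqxx.
rewrite -(@leq_exp2l 2)//.
apply: leq_trans (resultant_diff_poly_bound w.1 w.2 j0); rewrite -/R.
have -> : (\sum_(p <- s) (w \in res_pairs p j (2 ^ i.+1)))%N = size [seq p <- s | (p %| `|R|)%N].
  rewrite size_filter -sum1_count [RHS]big_mkcond; apply: eq_bigr => p _.
  by rewrite inE /= -/R R0 dvdzE /=; case: (dvdn p _).
apply: count_prime_divisors; rewrite ?absz_gt0 ?filter_uniq//.
by move=> q; rewrite mem_filter => /andP[-> /sp].
Qed.

(* (2^(i+1))^(3 n^3) dominates the values prod Q(-x_i) for x_i < 2^(i+1). *)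
Definition max_div (n i : nat) : nat :=
  \max_(m < ((2 ^ i.+1) ^ (3 * n ^ 3)).+1) size (divisors m).

(** The factors before the last make the threshold times H^j, with H = 2^i, at least twice the bound
    of [count_common_root]. The factor (i+1)^2 provides the logarithmic saving when primes are
    counted. *)
Definition threshold (n i : nat) : nat :=
  (2 * n * 2 ^ n * (2 * n * max_div n i) ^ n * i.+1 ^ 2)%N.

Lemma max_divP n i m : (m <= (2 ^ i.+1) ^ (3 * n ^ 3))%N -> (size (divisors m)
  <= max_div n i)%N.
Proof.
rewrite -ltnS => mB.
exact: (@leq_bigmax _ (fun m : 'I_((2 ^ i.+1) ^ (3 * n ^ 3)).+1
  => size (divisors m)) (Ordinal mB)).
Qed.

Lemma max_div_gt0 n i : (0 < max_div n i)%N.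
Proof. by apply: (leq_trans _ (@max_divP n i 1 _)); rewrite ?expn_gt0. Qed.

Lemma threshold_ge n i : (0 < n)%N -> (i.+1 ^ 2 <= threshold n i)%N.
Proof.
move=> n0; rewrite /threshold leq_pmull// !muln_gt0 !expn_gt0 /= n0 /= !muln_gt0 n0.
by rewrite max_div_gt0.
Qed.

(* The interval lengths h in ]2^(i-1), 2^i] are treated together; dividing the
   last inequality by p gives M^2 > threshold^2 (H^(2j) + H^(4j-1) / p) with
   H = 2^i, which is the size of h^(2j) + h^(4j-1) / p. *)
Definition bad (n i j p : nat) : bool :=
  [exists h : 'I_p.+1, exists s : 'F_p, [&& (2 ^ i < 2 * h)%N, (h <= 2 ^ i)%N &
    (threshold n i ^ 2 * (p * (2 ^ i) ^ (2 * j)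
      + (2 ^ i) ^ (4 * j - 1)) < disjoint_count j h s ^ 2 * p)%N]].

(** Badness makes M exceed the threshold times H^j, hence 2 [Z0], so [second_moment] applies.
    Passing from h to 2^i < 2 h turns its factor 2 j into 4 j. *)
Lemma bad_moment n i j p : (0 < j <= n)%N -> prime p -> bad n i j p ->
  exists M : nat, [/\ (2 ^ i * M ^ 2 <= 4 * j * #|res_pairs p j (2 ^ i.+1)|)%N,
   (threshold n i ^ 2 * (2 ^ i) ^ (2 * j) <= M ^ 2)%N &
   (threshold n i ^ 2 * (2 ^ i) ^ (4 * j - 1) <= M ^ 2 * p)%N].
Proof.
move=> /andP[j0 jn] pp /existsP[h /existsP[s /and3P[h1 h2 hM]]]; exists (disjoint_count j h s).
have p0 := prime_gt0 pp; set M := disjoint_count j h s in hM *;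
  set H := (2 ^ i)%N in h1 h2 hM *.
set G := threshold n i in hM *.
have GM : (G ^ 2 * H ^ (2 * j) < M ^ 2)%N.
  rewrite -(ltn_pmul2r p0) (leq_ltn_trans _ hM)//.
  rewrite mulnDr; apply: leq_trans (leq_addr _ _); rewrite -mulnA leq_mul2l [(_ * p)%N]mulnC.
  by rewrite leqnn orbT.
split; [|exact: ltnW|by rewrite (leq_trans _ (ltnW hM))// mulnDr leq_addl].
have HL : (2 ^ i.+1)%N = (2 * H)%N by rewrite expnS.
have hL : (h + h <= 2 ^ i.+1)%N by rewrite HL; lia.
set Z0 := (j * ((2 ^ i.+1) ^ j * (2 * j * max_div n i) ^ j))%N.
have D0 := max_div_gt0 n i.
have GM' : (G * H ^ j < M)%N by move: GM;
  rewrite mulnC [(2 * j)%N]mulnC expnM -expnMn mulnC ltn_exp2r.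
have ZM : (2 * Z0 <= M)%N.
  apply: leq_trans (ltnW GM'); rewrite /G /threshold /Z0 HL expnMn.
  have a : (2 * j * max_div n i <= 2 * n * max_div n i)%N
    by rewrite leq_mul2r leq_mul2l jn !orbT.
  have b : ((2 * j * max_div n i) ^ j <= (2 * n * max_div n i) ^ n)%N.
    apply: (@leq_trans ((2 * n * max_div n i) ^ j)); first by rewrite leq_exp2r.
    by rewrite leq_pexp2l// !muln_gt0 D0 (leq_trans j0 jn).
  have c : (2 ^ j <= 2 ^ n)%N by rewrite leq_exp2l.
  apply: (@leq_trans (2 * (n * (2 ^ n * H ^ j * (2 * n * max_div n i) ^ n)))).
    by rewrite leq_mul2l /= leq_mul// leq_mul// leq_mul.
  move: (2 ^ n)%N (H ^ j)%N ((2 * n * max_div n i) ^ n)%N => c2 X B2.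
  have I0 : (0 < i.+1 ^ 2)%N by rewrite expn_gt0.
  rewrite (_
    : 2 * n * c2 * B2 * i.+1 ^ 2 * X = 2 * (n * (c2 * X * B2)) * i.+1 ^ 2)%N ?leq_pmulr//.
  by move: (i.+1 ^ 2)%N => I; lia.
have hp : (h <= p)%N by rewrite -ltnS.
have := @second_moment p j h (2 ^ i.+1) pp j0 s Z0 hp hL.
rewrite -/M => /(_ _ ZM) sm; apply: (@leq_trans (2 * h * M ^ 2)).
  by rewrite leq_mul2r ltnW ?orbT.
rewrite -mulnA (_ : 4 * j * _ = 2 * (2 * j * #|res_pairs p j (2 ^ i.+1)|))%N; last by lia.
rewrite leq_mul2l /=; apply: sm => w w0.
(* With c = L^j, the bound B = L^(j + 2 j^2) dominates c (L + c j)^j because L + L^j j <= L^(2j).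
   Its j-th power is at most L^(3 n^3), the range covered by [max_div]. *)
apply: (@count_common_root j _ ((2 ^ i.+1) ^ (j
  + 2 * j ^ 2)) (max_div n i) _ w ((2 ^ i.+1) ^ j)) => //.
- move=> m /andP[m0 mB]; apply: max_divP; apply: leq_trans mB _.
  rewrite -!expnM leq_exp2l//; set I := i.+1.
  rewrite leq_mul2l; apply/orP; right.
  have j3 : (j ^ 3 <= n ^ 3)%N by rewrite leq_exp2r.
  nia.
- by rewrite !expn_gt0.
- exact: coef_diff_poly.
set L := (2 ^ i.+1)%N; have L2 : (2 <= L)%N by rewrite /L -[X in (X <= _)%N]expn1 leq_exp2l.
have Lj : (L + L ^ j * j <= L ^ (2 * j))%N.
  apply: (@leq_trans (L ^ j * 2 ^ j)).
    apply: (@leq_trans (L ^ j * j.+1)).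
      rewrite mulnS leq_add2r -[X in (X <= _)%N]expn1 leq_pexp2l//.
      exact: leq_trans L2.
    by rewrite leq_mul2l ltn_expl ?orbT.
  by rewrite -expnMn mul2n -addnn expnD -expnMn leq_exp2r// leq_mul2l L2 orbT.
rewrite expnD leq_mul2l; apply/orP; right.
by rewrite -[(j ^ 2)%N]/(j * j)%N mulnA expnM leq_exp2r.
Qed.

(** Here 24 j^3 is 4 j times 6 j^2, and 16^n bounds the factor 2^(4j) due to intervals of length 2
    H. *)
Definition bad_const n := (24 * n ^ 3 * 16 ^ n)%N.

(** Both bounds come from summing [bad_moment] over the primes and comparing with [sum_res_pairs].
    In the first, threshold^2 >= (i+1)^4 meets a loss of i+1, which leaves (i+1)^3. The second is
    free of T and serves for small i. *)
Lemma count_bad (n i j T : nat) (s : seq nat) : (0 < j <= n)%N -> uniq s ->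
  (forall p, p \in s -> [/\ prime p, (p <= T)%N & bad n i j p]) ->
  (size s * i.+1 ^ 3 <= bad_const n * T)%N /\ (size s
    <= bad_const n * i.+1 * (2 ^ i) ^ (2 * n))%N.
Proof.
move=> jn us sP; have /andP[j0 jn'] := jn; set H := (2 ^ i)%N.
have H0 : (0 < H)%N by rewrite expn_gt0.
have sp p : p \in s -> prime p by case/sP.
have Ks : (4 * j * \sum_(p <- s) #|res_pairs p j (2 ^ i.+1)|
  <= bad_const n * i.+1 * H ^ (4 * j))%N.
  apply: (leq_trans (leq_mul (leqnn _) (sum_res_pairs i j0 us sp))).
  rewrite -(expnM _ j 4) (expnS 2 i) -/H expnMn.
  have a : (2 ^ (j * 4) <= 16 ^ n)%N by rewrite mulnC expnM leq_exp2l.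
  have b : (j ^ 3 <= n ^ 3)%N by rewrite leq_exp2r.
  rewrite (mulnC j 4) in a *; set X := (H ^ _)%N; set E := (2 ^ _)%N in a *.
  rewrite (_ : 4 * j * (6 * j ^ 2 * i.+1 * (E * X)) = 24 * j ^ 3 * E * i.+1 * X)%N; last first.
    by rewrite -[(j ^ 2)%N]/(j * j)%N -[(j ^ 3)%N]/(j * (j * j))%N; lia.
  by rewrite leq_mul// leq_mul// leq_mul// leq_mul.
have G0 := threshold_ge i (leq_trans j0 jn').
have e1 : (H ^ (4 * j) = H * H ^ (4 * j - 1))%N by rewrite -expnS; congr (_ ^ _)%N; lia.
split.
- have : (\sum_(p <- s) threshold n i ^ 2 * H ^ (4 * j)
  <= T * (bad_const n * i.+1 * H ^ (4 * j)))%N.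
    apply: leq_trans (leq_mul (leqnn T) Ks); rewrite !big_distrr /= big_seq [X in (_
      <= X)%N]big_seq.
    apply: leq_sum => p /sP[pp pT /(bad_moment jn pp)[M []]]; rewrite -/H e1.
    set r := #|_|; set Q := (H ^ _)%N; set Q' := (H ^ _)%N; set G := threshold n i => m1 _ m3.
    apply: (@leq_trans (H * (M ^ 2 * p))).
      by rewrite mulnCA leq_mul2l m3 orbT.
    rewrite mulnA mulnC; apply: leq_mul => //.
  rewrite big_const_seq count_predT iter_addn_0.
  have HH : (0 < H ^ (4 * j))%N by rewrite expn_gt0 H0.
  rewrite mulnAC mulnA leq_pmul2r// => m.
  have {}m : ((i.+1 ^ 2) ^ 2 * size s <= T * (bad_const n * i.+1))%N.
    by apply: leq_trans m; rewrite leq_mul2r leq_exp2r// G0 orbT.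
  rewrite -(@leq_pmul2r i.+1)//; apply: leq_trans (leq_trans m _).
    by rewrite -expnM; nia.
  by rewrite mulnA [(T * _)%N]mulnC.
have : (\sum_(p <- s) H ^ (2 * j).+1 <= bad_const n * i.+1 * H ^ (4 * j))%N.
  apply: leq_trans Ks; rewrite !big_distrr /= big_seq [X in (_ <= X)%N]big_seq.
  apply: leq_sum => p /sP[pp pT /(bad_moment jn pp)[M []]]; rewrite -/H.
  move=> m1 m2 _; apply: leq_trans m1; rewrite expnS leq_mul2l; apply/orP; right.
  apply: leq_trans m2; rewrite leq_pmull// expn_gt0.
  by rewrite (leq_trans _ G0) ?expn_gt0.
rewrite big_const_seq count_predT iter_addn_0.
have e2 : (H ^ (4 * j) = H ^ (2 * j).+1 * H ^ (2 * j - 1))%N by rewrite -expnD;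
  congr (_ ^ _)%N; lia.
rewrite e2 mulnA mulnAC mulnC leq_pmul2r ?expn_gt0 ?H0// => m.
apply: leq_trans m _; rewrite leq_mul2l; apply/orP; right.
rewrite leq_pexp2l//; lia.
Qed.

(** * Size of the threshold and density of the exceptional primes *)

Section Threshold.
Local Open Scope nat_scope.

(** The threshold is O(2^(i/k)). The divisor bound with exponent 2 n k (3 n^3) gives [max_div]^(2 n
    k) = O(2^i), and (i+1)^(4k) = O(2^i); together they bound the 2k-th power of the threshold by
    O(4^i). *)
Lemma threshold_pow n k : 0 < n -> 0 < k
  -> exists2 C, 0 < C & forall i, threshold n i ^ k <= C * 2 ^ i.
Proof.
move=> n0 k0; have [C C0 CP] := divisors_pow_bound (2 * n * k * (3 * n ^ 3)).
have [C' C'P] := poly_le_exp2 (4 * k).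
set A := ((2 * n * 2 ^ n * (2 * n) ^ n) ^ (2 * k)).
have C'0 : 0 < C' by have := C'P 0; rewrite exp1n expn0 muln1.
have A0 : 0 < A by rewrite !(expn_gt0, muln_gt0) n0.
have c0 : 0 < A * (2 * C) * C' by rewrite !muln_gt0 A0 C0 C'0.
exists (A * (2 * C) * C') => // i.
have n3 : 0 < 3 * n ^ 3 by rewrite muln_gt0 expn_gt0 n0.
have Dk : max_div n i ^ (2 * n * k) <= 2 * C * 2 ^ i.
  rewrite -(@leq_exp2r _ _ (3 * n ^ 3))// -expnM.
  rewrite /max_div; have [|m ->] := @bigop.eq_bigmax _ (fun m
    : 'I_((2 ^ i.+1) ^ (3 * n ^ 3)).+1 => size (divisors m)).
    by rewrite card_ord.
  have [->|m0] := posnP (m : nat).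
    by rewrite [size _]/= exp1n expn_gt0 !muln_gt0 C0 expn_gt0.
  apply: leq_trans (CP _ m0) _.
  rewrite (_ : 2 * C * 2 ^ i = C * 2 ^ i.+1); last by rewrite expnS; lia.
  rewrite expnMn; apply: leq_mul; last by rewrite -ltnS.
  by rewrite -[X in X <= _]expn1 leq_pexp2l.
rewrite -(@leq_exp2r _ _ 2)// -expnM mulnC.
apply: (@leq_trans (A * (2 * C) * C' * (2 ^ i) ^ 2)); last first.
  by rewrite expnMn leq_mul2r -[X in X <= _]expn1 leq_pexp2l ?orbT.
have -> : threshold n i ^ (2 * k) = A * max_div n i ^ (2 * n * k) * i.+1 ^ (4 * k).
  rewrite /threshold /A !expnMn -!expnM.
  have <- : i.+1 ^ (2 * k) * i.+1 ^ (2 * k) = i.+1 ^ (4 * k) by rewrite -expnD;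
    congr (_ ^ _); lia.
  have -> : n * (2 * k) = 2 * n * k by lia.
  by lia.
have -> : A * (2 * C) * C' * (2 ^ i) ^ 2 = A * (2 * C * 2 ^ i) * (C' * 2 ^ i) by lia.
by rewrite !leq_mul// C'P.
Qed.

(** The scale i goes up to [trunc_log 2 T] + 1, since h <= T is rounded up to a power of 2. All
    sizes j up to n occur, as removing common factors shortens the products. *)
Definition exceptional (n T p : nat) : bool :=
  prime p && [exists j : 'I_n.+1, exists i : 'I_(trunc_log 2 T).+2, (0 < j) && bad n i j p].

Definition exceptional_seq (n T : nat) : seq nat :=
  [seq p <- iota 0 T.+1 | exceptional n T p].

(** Each pair (i, j) accounts for O(T / l^3) primes, where l is the binary logarithm of T, and there
    are O(l) pairs. *)
Lemma count_exceptional n : 0 < n -> exists2 C, 0 < C & forall T, 2 <= T ->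
  size (exceptional_seq n T) * trunc_log 2 T ^ 2 <= C * T.
Proof.
move=> n0; have [C8 C8P] := poly_le_exp2 8.
have C80 : 0 < C8 by have := C8P 0; rewrite exp1n expn0 muln1.
pose C1 := (64 * n ^ 3 + C8) * bad_const n.
have K00 : 0 < bad_const n by rewrite !muln_gt0 !expn_gt0 n0.
have C10 : 0 < C1 by rewrite /C1 muln_gt0 K00 addn_gt0 C80 orbT.
exists (3 * n.+1 * C1); first by rewrite muln_gt0 C10.
move=> T T2; set l := trunc_log 2 T.
have l0 : 0 < l by rewrite trunc_log_gt0 /=; lia.
have lT : 2 ^ l <= T by apply: trunc_logP; rewrite // ltnW.
pose N i j := size [seq p <- iota 0 T.+1 | prime p && bad n i j p].
have Nl (j : 'I_n.+1) (i : 'I_l.+2) : 0 < j -> N i j * l ^ 3 <= C1 * T.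
  move=> j0; have jn : 0 < j <= n by rewrite j0 -ltnS /=.
  have us : uniq [seq p <- iota 0 T.+1 | prime p && bad n i j p]
    by rewrite filter_uniq ?iota_uniq.
  have [] := @count_bad n i j T _ jn us.
    by move=> p; rewrite mem_filter mem_iota => /andP[/andP[-> ->]].
  rewrite -/(N i j) => N1 N2.
  (* For l <= 4 n (i+1), the first bound of [count_bad] saves a multiple of l^3. Otherwise
     (2^i)^(4n) <= 2^l, so the second bound is about the square root of T; comparing squares leaves
     l^8 = O(2^l). *)
  have [li|li] := leqP l (4 * n * i.+1).
    apply: (@leq_trans (N i j * ((4 * n) ^ 3 * i.+1 ^ 3))).
      by rewrite leq_mul2l -expnMn leq_exp2r// li orbT.
    rewrite mulnCA expnMn (leq_trans (leq_mul (leqnn _) N1))//.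
    by rewrite /C1 (_ : 64 = 4 ^ 3)// mulnDl mulnDl mulnA leq_addr.
  apply: (@leq_trans (bad_const n * C8 * 2 ^ l)); last first.
    by rewrite leq_mul// /C1 mulnDl [bad_const n * C8]mulnC leq_addl.
  rewrite -(@leq_exp2r _ _ 2)//.
  apply: (@leq_trans ((bad_const n * l * (2 ^ i) ^ (2 * n) * l ^ 3) ^ 2)).
    rewrite leq_exp2r// leq_mul2r (leq_trans N2) ?orbT//.
    by rewrite leq_mul2r leq_mul2l (leq_trans _ (ltnW li)) ?orbT// leq_pmull// muln_gt0 n0.
  have -> : (bad_const n * l * (2 ^ i) ^ (2 * n) * l ^ 3) ^ 2 = bad_const n ^ 2 * (l ^ 8 * (2 ^ i) ^ (4 * n)).
    have -> : (2 ^ i) ^ (4 * n) = ((2 ^ i) ^ (2 * n)) ^ 2 by rewrite -!expnM;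
      congr (_ ^ _); lia.
    by rewrite !expnMn -!expnM; lia.
  apply: (@leq_trans (bad_const n ^ 2 * (C8 * 2 ^ l * 2 ^ l))).
    rewrite leq_mul2l leq_mul ?orbT//.
      by rewrite (leq_trans _ (C8P l))// leq_exp2r.
    rewrite -expnM leq_exp2l// (leq_trans _ (ltnW li))//; lia.
  rewrite !expnMn -[X in _
    <= X]mulnA -[C8 * _ * _]mulnA (mulnn (2 ^ l)) leq_mul2l leq_mul ?orbT//.
  by rewrite -[X in X <= _]expn1 leq_pexp2l.
have tot : size (exceptional_seq n T) <= \sum_(j < n.+1 | 0 < j) \sum_(i < l.+2) N i j.
  rewrite /exceptional_seq size_filter -sum1_count big_mkcond /=.
  apply: (@leq_trans (\sum_(p <- iota 0 T.+1) \sum_(j < n.+1 | 0 < j) \sum_(i < l.+2) (prime p && bad n i j p))).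
    apply: leq_sum => p _; case: ifP => // /andP[pp /existsP[j /existsP[i /andP[j0 b]]]].
    by rewrite (bigD1 j)//= (bigD1 i)//= pp b.
  rewrite exchange_big /=; apply: leq_sum => j _; rewrite exchange_big /=;
    apply: leq_sum => i _.
  rewrite /N size_filter -sum1_count [X in _ <= X]big_mkcond; apply: leq_sum => p _.
  by case: (_ && _).
rewrite -(@leq_pmul2r l)//.
have : size (exceptional_seq n T) * l ^ 3 <= n.+1 * (l.+2 * (C1 * T)).
  apply: leq_trans (leq_mul tot (leqnn _)) _.
  rewrite big_distrl /= -[X in X * (_ * _)]card_ord -sum_nat_const big_mkcond.
  apply: leq_sum => j _; case: ifP => // j0.
  rewrite big_distrl /= -[X in X * (_ * _)](card_ord l.+2) -sum_nat_const.
  by apply: leq_sum => i _; apply: Nl.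
rewrite -mulnA -expnSr => /leq_trans; apply.
have : l.+2 <= 3 * l by lia.
clear C10; move: C1 Nl => c1 Nl h.
apply: leq_trans (leq_mul (leqnn _) (leq_mul h (leqnn _))) _.
lia.
Qed.

End Threshold.

(** * Multiplicative congruences *)

(* The psi i are the characters of the unit group, extended by 0 at 0. *)
Lemma dual_orthogonality (F : finFieldType) :
  exists (I : finType) (psi : I -> F -> algC) (N : nat),
  [/\ (0 < N)%N, forall i u v, psi i (u * v) = psi i u * psi i v, forall i, psi i 1 = 1 &
   forall u v, \sum_i psi i u * (psi i v)^* = ((u == v) && (u != 0))%:R *+ N].
Proof.
pose G := [set: {unit F}]%G.
have abG : abelian G by apply/centsP => x _ y _; apply/val_inj; rewrite /= mulrC.
pose psi (i : Iirr G) (u : F) : algC := if insub u is Some x then 'chi_i (x : {unit F}) else 0.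
have lin i : 'chi[G]_i \is a linear_char by apply/char_abelianP.
exists (Iirr G), psi, #|G|; split.
- exact: cardG_gt0.
- move=> i u v; rewrite /psi.
  case: (insubP _ u) => [x xu ux|]; last first.
    rewrite unitfE negbK => /eqP ->; rewrite !mul0r.
    by case: insubP => // x; rewrite unitr0.
  case: (insubP _ v) => [y yv vy|]; last first.
    rewrite unitfE negbK => /eqP ->; rewrite !mulr0.
    by case: insubP => // z; rewrite unitr0.
  case: insubP => [z _ zuv|]; last by rewrite unitrM xu yv.
  rewrite -(lin_charM (lin i)) ?inE//; congr ('chi_i _); apply/val_inj.
  by rewrite /= zuv -ux -vy.
- move=> i; rewrite /psi; case: insubP => [z _ z1|]; last by rewrite unitr1.
  rewrite (_ : z = 1%g) ?(lin_char1 (lin i))//.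
  exact/val_inj.
move=> u v; rewrite /psi.
case: (insubP _ u) => [x xu ux|]; last first.
  rewrite unitfE negbK => /eqP ->; rewrite eqxx andbF mul0rn.
  by apply: big1 => i _; rewrite mul0r.
case: (insubP _ v) => [y yv vy|]; last first.
  rewrite unitfE negbK => /eqP ->; rewrite big1 => [|i _]; last by rewrite conjC0 mulr0.
  by move: xu; rewrite unitfE => u0; rewrite (negPf u0) mul0rn.
rewrite second_orthogonality_relation ?inE//.
have -> : ('C_G[x] = G)%g.
  by apply/finset.setIidPl; rewrite sub_cent1 (fintype.subsetP abG)// inE.
move: xu; rewrite unitfE => ->; rewrite andbT.
have -> : (x \in y ^: G)%g = (u == v).
  rewrite (abelian_classP _ abG) ?inE//.
  by rewrite -ux -vy (inj_eq val_inj).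
by rewrite mulrb; case: eqP => //; rewrite ?mulr1n ?mul0rn.
Qed.

(** The solutions are roots of X^n - v; a negative exponent is handled by inverting u. *)
Lemma card_exprz_eq (F : finFieldType) (e : int) (u : F) : e != 0 -> u != 0 ->
  (#|[pred w : F | (w ^ e == u)%R]| <= `|e|)%N.
Proof.
move=> e0 u0.
suff main (n : nat) (v : F) : (0 < n)%N -> (#|[pred w : F | (w ^+ n == v)%R]| <= n)%N.
  case: e e0 => n n0; first by apply: main; case: (n) n0.
  rewrite (leq_trans _ (main n.+1 u^-1 _))//; apply: subset_leq_card.
  by apply/fintype.subsetP => w; rewrite !inE /= => /eqP <-; rewrite invrK.
move=> n0; rewrite cardE -ltnS -(size_XnsubC v n0).
apply: max_poly_roots (enum_uniq _); first by rewrite -size_poly_eq0 size_XnsubC.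
by apply/allP => w; rewrite mem_enum inE /root !hornerE subr_eq0.
Qed.

Section Mult.
Variables (F : finFieldType) (m h : nat).
Notation V := {ffun 'I_m -> 'I_h}.

Definition monomial (s : 'I_m -> F) (e : 'I_m -> int) (x : V) : F :=
  \prod_i (s i + (x i)%:R) ^ e i.

(* When no e i is 0, monomial s e x != 0 says that no s i + x i vanishes. *)
Definition monomial_count (s : 'I_m -> F) (e : 'I_m -> int) : nat :=
  #|[pred z : V * V | (monomial s e z.1 == monomial s e z.2) && (monomial s e z.1 != 0)]|.

Definition product_count (s : F) : nat := monomial_count (fun=> s) (fun=> 1).

(** By orthogonality, N times the count is the sum over characters of a product of m squared
    one-variable sums. The inequality of arithmetic and geometric means for each character separates
    the factors, and each resulting power sum is N times a count with equal shifts and exponents. *)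
Lemma monomial_count_holder (s : 'I_m -> F) (e : 'I_m -> int) : (0 < m)%N ->
  (m * monomial_count s e <= \sum_i monomial_count (fun=> s i) (fun=> e i))%N.
Proof.
move=> m0; have [I [psi [N [N0 psiM psi1 orth]]]] := dual_orthogonality F.
pose w s e a := \sum_(v : 'I_h) psi a ((s + (v : nat)%:R) ^ e).
have JE s' e' : (monomial_count s' e')%:R *+ N = \sum_a \prod_i `|w (s' i) (e' i) a| ^+ 2.
  transitivity (\sum_a `|\sum_(x : V) psi a (monomial s' e' x)| ^+ 2).
    transitivity (\sum_a \sum_(x : V) \sum_(y
      : V) psi a (monomial s' e' x) * (psi a (monomial s' e' y))^*); last first.
      apply: eq_bigr => a _; rewrite normCK rmorph_sum mulr_suml; apply: eq_bigr => x _.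
      by rewrite mulr_sumr.
    rewrite exchange_big /=.
    under [RHS]eq_bigr => x _.
      rewrite exchange_big /=.
      under eq_bigr => y _ do rewrite orth.
      over.
    rewrite (pair_big xpredT xpredT (fun x y =>
      ((monomial s' e' x == monomial s' e' y) && (monomial s' e' x != 0))%:R *+ N)) /=.
    by rewrite sumrMnl; congr (_ *+ _); rewrite /monomial_count card_sumb natr_sum.
  apply: eq_bigr => a _; rewrite prodrXl -normr_prod; congr (`|_| ^+ 2).
  rewrite /w bigA_distr_bigA /=; apply: eq_bigr => x _.
  rewrite /monomial; elim/big_rec2: _ => [|i y1 y2 _ <-]; first exact: psi1.
  exact: psiM.
rewrite -(ler_nat algC) -(@ler_pMn2r _ N)// natrM -mulrnAr JE natr_sum -sumrMnl.
under [X in _ <= X]eq_bigr do rewrite JE.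
rewrite exchange_big mulr_sumr /=; apply: ler_sum => a _.
set c := fun i => `|w (s i) (e i) a| ^+ 2.
have c0 i : 0 <= c i by rewrite exprn_ge0.
rewrite -[X in X * _]/(m%:R : algC) mulrC -ler_pdivlMr ?ltr0n//.
under [X in _ <= X / _]eq_bigr do rewrite prodr_const card_ord -/(c _).
(* Applied to the m-th powers of the c i, so that taking m-th roots leaves their plain product. *)
have := @leif_AGM algC 'I_m predT (fun i => c i ^+ m).
rewrite cardE size_enum_ord => /(_ _)/leif_le H.
have P0 : 0 <= \prod_i c i by apply: prodr_ge0.
have S0 : 0 <= (\sum_i c i ^+ m) / m%:R.
  by rewrite divr_ge0// sumr_ge0// => i _; rewrite exprn_ge0.
rewrite -[leLHS]/(\prod_i c i) -(@ler_pXn2r _ m)//.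
by rewrite -prodrXl; apply: H => i _; rewrite exprn_ge0.
Qed.

Lemma sum_fiber (T : finType) (P : T -> F) (f : F -> nat) :
  (\sum_x f (P x) = \sum_v #|[pred x | P x == v]| * f v)%N.
Proof.
rewrite (partition_big P xpredT)//=; apply: eq_bigr => v _.
by rewrite -sum_nat_const; apply: eq_big => [x|x /eqP ->].
Qed.

(** The monomial is the e-th power of the plain product. With c(v) the number of x with product v,
    the inequality 2 c(v) c(w) <= c(v)^2 + c(w)^2 reduces to the diagonal, and each v != 0 has at
    most |e| partners w with w^e = v^e. *)
Lemma monomial_count_const (s : F) (e : int) : e != 0 ->
  (monomial_count (fun=> s) (fun=> e) <= `|e| * product_count s)%N.
Proof.
move=> e0; pose P := monomial (fun=> s) (fun=> 1).
have PE x : monomial (fun=> s) (fun=> e) x = P x ^ e.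
  rewrite /P /monomial; elim/big_rec2: _ => [|i y1 y2 _ ->]; first by rewrite exp1rz.
  by rewrite expfzMl.
pose c v := #|[pred x | P x == v]|.
have JE (R : F -> F -> bool) : #|[pred z : V * V | R (P z.1) (P z.2)]| =
    (\sum_v \sum_w c v * c w * R v w)%N.
  rewrite card_sumb -(pair_big xpredT xpredT (fun x y => R (P x) (P y) : nat)) /=.
  rewrite (sum_fiber P (fun v => \sum_y R v (P y)))%N; apply: eq_bigr => v _.
  rewrite (sum_fiber P (fun w => R v w : nat)) big_distrr /=; apply: eq_bigr => w _.
  by rewrite mulnA.
have -> : monomial_count (fun=> s) (fun=> e) = (\sum_v \sum_w c v * c w * ((v ^ e == w ^ e) && (v ^ e != 0))%R)%N.
  by rewrite -JE; apply: eq_card => z; rewrite !inE !PE.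
have -> : product_count s = (\sum_v c v * c v * (v != 0%R))%N.
  rewrite /product_count /monomial_count (JE (fun v w => (v == w) && (v != 0)));
    apply: eq_bigr => v _.
  rewrite (bigD1 v)//= eqxx big1 ?addn0// => w wv.
  by rewrite eq_sym (negPf wv) muln0.
rewrite -(@leq_pmul2l 2)//.
have cnt (v : F) : v != 0 -> (\sum_(w : F) ((v ^ e == w ^ e) && (v ^ e != 0))%R <= `|e|)%N.
  move=> v0; have ve0 : v ^ e != 0 by rewrite expfz_neq0.
  apply: leq_trans (card_exprz_eq e0 ve0).
  by rewrite card_sumb; apply: leq_sum => w _; rewrite inE eq_sym; case: (_ == _);
    rewrite ?leq_b1.
apply: (@leq_trans (\sum_v \sum_w (c v * c v + c w * c w) * ((v ^ e == w ^ e)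
  && (v ^ e != 0))%R)).
  rewrite big_distrr /=; apply: leq_sum => v _; rewrite big_distrr /=; apply: leq_sum => w _.
  by rewrite mulnA leq_mul2r; have := nat_Cauchy (c v) (c w); rewrite /leqif => -[+ _];
    rewrite -!mulnn => ->; rewrite orbT.
have half : (\sum_v \sum_w (c v * c v) * ((v ^ e == w ^ e) && (v ^ e != 0))%R <=
    `|e| * \sum_v c v * c v * (v != 0%R))%N.
  rewrite big_distrr /=; apply: leq_sum => v _; rewrite -big_distrr /=.
  have [->|v0] := eqVneq v 0.
    by rewrite exp0rz (negPf e0) eqxx big1 ?muln0// => w _; rewrite andbF.
  by rewrite muln1 mulnC leq_mul2r cnt ?orbT.
under eq_bigr do under eq_bigr do rewrite mulnDl.
under eq_bigr do rewrite big_split /=.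
rewrite big_split /= mul2n -addnn leq_add//.
apply: leq_trans half; rewrite exchange_big /=; apply: leq_sum => v _; apply: leq_sum => w _.
by rewrite eq_sym; case: eqVneq => // ->.
Qed.
End Mult.

(** A solution with a common entry x_i = y_l, for one of (m+1)^2 positions, loses its nonzero common
    factor: it is determined by the entry, with h choices, and a solution of length m. *)
Lemma product_count_step p m h (s : 'F_p) : prime p ->
  (@product_count 'F_p m.+1 h s <= disjoint_count m.+1 h s
    + m.+1 ^ 2 * (h * @product_count 'F_p m h s))%N.
Proof.
move=> pp; pose V := {ffun 'I_m.+1 -> 'I_h}.
pose P k (x : {ffun 'I_k -> 'I_h}) := \prod_i (s + (x i)%:R).
have PE k (x : {ffun 'I_k -> 'I_h}) : monomial (fun=> s) (fun=> 1) x = P k x by [].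
pose S (k : nat) := [pred z : {ffun 'I_k -> 'I_h} * {ffun 'I_k
  -> 'I_h} | (P k z.1 == P k z.2) && (P k z.1 != 0)].
have KE k : @product_count 'F_p k h s = #|S k| by [].
rewrite !KE {KE}.
apply: (@leq_trans (disjoint_count m.+1 h s + \sum_(il
  : 'I_m.+1 * 'I_m.+1) #|[pred z in S m.+1 | z.1 il.1 == z.2 il.2]|)).
  under eq_bigr do rewrite card_sumb.
  rewrite exchange_big /disjoint_count !card_sumb -big_split /=; apply: leq_sum => z _.
  case: (boolP (z \in S m.+1)) => // zS.
  have [dz|dz] := boolP (disjoint_entries z).
    rewrite !inE dz (leq_trans _ (leq_addr _ _))//= root_diff_poly.
    by move: zS; rewrite inE => /andP[->].
  have /existsP[i /existsP[l il]] : [exists i, exists l, z.1 i == z.2 l].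
    move: dz; rewrite /disjoint_entries negb_forall => /existsP[u].
    rewrite negb_forall => /existsP[v]; rewrite negbK => uv.
    by apply/existsP; exists u; apply/existsP; exists v.
  rewrite (leq_trans _ (leq_addl _ _))// (bigD1 (i, l))//= inE zS /= il.
  by [].
rewrite leq_add2l; apply: (@leq_trans (\sum_(il : 'I_m.+1 * 'I_m.+1) h * #|S m|)); last first.
  by rewrite sum_nat_const card_prod card_ord.
apply: leq_sum => -[i l] _ /=.
rewrite -[X in (_ <= X * _)%N]card_ord -cardX.
pose f (z : V * V) : 'I_h * ({ffun 'I_m -> 'I_h} * {ffun 'I_m -> 'I_h}) :=
  (z.1 i, ([ffun a => z.1 (lift i a)], [ffun a => z.2 (lift l a)])).
have fI : {in [pred z in S m.+1 | z.1 i == z.2 l] &, injective f}.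
  move=> [x y] [x' y']; rewrite !inE /=
    => /andP[_ /eqP e1] /andP[_ /eqP e2] [e3 /ffunP ex /ffunP ey].
  congr (_, _); apply/ffunP => a.
    by case: (unliftP i a) => [b ->|->//]; have := ex b; rewrite !ffunE.
  by case: (unliftP l a) => [b ->|->]; [have := ey b; rewrite !ffunE|rewrite -e1 -e2].
rewrite -(fintype.card_in_image fI); apply: subset_leq_card; apply/fintype.subsetP
  => _ /fintype.imageP[z zS ->].
rewrite inE /=; move: zS; rewrite !inE => /andP[/andP[/eqP E n0] /eqP zil].
have PD (x : V) (b : 'I_m.+1) : P _ x = (s + (x b)%:R) * P m [ffun a => x (lift b a)].
  rewrite /P (bigD1_ord b)//=; congr (_ * _); apply: eq_bigr => a _.
  by rewrite ffunE.
move: n0 E; rewrite (PD z.1 i) (PD z.2 l) zil mulf_eq0 negb_or => /andP[n1 n2].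
by move=> /(mulfI n1) E; rewrite E eqxx -E.
Qed.

(* In terms of a = h^(1/4) and b = p^(1/4) all the exponents in the final
   estimate are natural numbers. *)
Lemma disjoint_count_not_bad (R : realFieldType) n i j p h (s : 'F_p) (a b : R) :
  (0 < j)%N -> 1 <= a -> 0 <= b -> a ^+ 4 = h%:R -> b ^+ 4 = p%:R ->
  (h <= p)%N -> (h <= 2 ^ i)%N -> (2 ^ i < 2 * h)%N -> ~~ bad n i j p ->
  (disjoint_count j h s)%:R * b ^+ 2 <=
    (threshold n i * 4 ^ j)%:R * (b ^+ 2 * a ^+ (4 * j) + a ^+ (8 * j - 2)).
Proof.
move=> j0 a1 b0 ah bp hp hi ih; have a0 : 0 <= a by apply: le_trans a1.
rewrite /bad negb_exists => /forallP/(_ (Ordinal (hp : (h < p.+1)%N))).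
rewrite negb_exists => /forallP/(_ s); rewrite /= ih hi /= -leqNgt.
set K := disjoint_count _ _ _; set G := threshold n i => KG.
have H2 : ((2 ^ i)%N%:R : R) <= 2 * a ^+ 4 by rewrite ah -natrM ler_nat ltnW.
have HX k : ((2 ^ i)%N%:R : R) ^+ k <= 2 ^+ k * a ^+ (4 * k).
  by rewrite exprM -exprMn lerXn2r ?nnegrE ?ler0n ?mulr_ge0 ?exprn_ge0.
set W := _ + _; have W0 : 0 <= W by rewrite addr_ge0 ?mulr_ge0 ?exprn_ge0.
rewrite -(@ler_pXn2r _ 2)// ?nnegrE ?mulr_ge0 ?exprn_ge0//.
have -> : ((K%:R : R) * b ^+ 2) ^+ 2 = (K ^ 2 * p)%:R.
  by rewrite natrM natrX -bp; ring.
apply: (@le_trans _ _ (G ^ 2 * (p * (2 ^ i) ^ (2 * j) + (2 ^ i) ^ (4 * j - 1)))%:R).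
  by rewrite ler_nat.
rewrite natrM natrD natrM -bp !natrX exprMn natrM natrX exprMn -mulrA.
rewrite ler_wpM2l ?exprn_ge0//.
have e1 : (4 : R) ^+ j ^+ 2 = 2 ^+ (4 * j).
  by rewrite -exprM (_ : (4 : R) = 2 ^+ 2) -?exprM; [congr (_ ^+ _); lia|rewrite expr2; lra].
have := HX (2 * j)%N; rewrite natrX => h1; have := HX (4 * j - 1)%N; rewrite natrX => h2.
have p1 : (2 : R) ^+ (2 * j) <= 2 ^+ (4 * j) by rewrite ler_weXn2l ?ler1n//; lia.
have p2 : (2 : R) ^+ (4 * j - 1) <= 2 ^+ (4 * j) by rewrite ler_weXn2l ?ler1n//; lia.
set X := b ^+ 2 * a ^+ (4 * j) in W W0 *; set Y := a ^+ (8 * j - 2) in W W0 *.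
have X0 : 0 <= X by rewrite mulr_ge0 ?exprn_ge0.
have Y0 : 0 <= Y by rewrite exprn_ge0.
apply: (@le_trans _ _ (2 ^+ (4 * j) * (X ^+ 2 + Y ^+ 2))).
  rewrite mulrDr; apply: lerD.
    apply: (le_trans (ler_wpM2l (exprn_ge0 4 b0) h1)).
    rewrite [X ^+ 2](_ : _ = b ^+ 4 * a ^+ (4 * (2 * j))); last first.
      by rewrite /X exprMn -!exprM; congr (_ * _ ^+ _); clear; lia.
    by rewrite mulrCA ler_wpM2r// mulr_ge0 ?exprn_ge0.
  apply: (le_trans h2); rewrite [Y ^+ 2](_ : _ = a ^+ (4 * (4 * j - 1))).
    by rewrite ler_wpM2r// exprn_ge0.
  by rewrite /Y -exprM; congr (_ ^+ _); clear; lia.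
rewrite e1 ler_wpM2l ?exprn_ge0// /W sqrrD.
have : 0 <= X * Y by rewrite mulr_ge0.
lra.
Qed.

(** The bound is of order G (h^m + h^(2m - 1/2) / p^(1/2)). It is preserved by [product_count_step],
    where each removed factor costs h = a^4. *)
Lemma product_count_bound (m : nat) : exists c : nat, forall (R : realFieldType) p h (s
  : 'F_p) (a b : R) (G : nat),
  prime p -> 1 <= a -> 1 <= b -> a ^+ 4 = h%:R -> (0 < G)%N ->
  (forall j, (0 < j <= m)%N ->
    (disjoint_count j h s)%:R * b ^+ 2 <= G%:R * (b ^+ 2 * a ^+ (4 * j) + a ^+ (8 * j - 2))) ->
  (@product_count 'F_p m h s)%:R * b ^+ 2 <= c%:R * G%:R * (b ^+ 2 * a ^+ (4 * m)
    + a ^+ (8 * m - 2)).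
Proof.
elim: m => [|m [c IH]].
  (* For m = 0 the truncated exponent 8 m - 2 is 0, so the second term is 1. *)
  exists 1%N => R p h s a b G pp a1 b1 ah G0 _.
  have K1 : (@product_count 'F_p 0 h s <= 1)%N.
    by rewrite (leq_trans (max_card _))// card_prod card_ffun !card_ord.
  have b2 : 0 <= b ^+ 2 by rewrite exprn_ge0// (le_trans _ b1).
  apply: (@le_trans _ _ (b ^+ 2)).
    by rewrite -[X in _ <= X]mul1r ler_wpM2r// lern1.
  rewrite mul1r !muln0 mulr1 expr0 (le_trans (_ : _ <= b ^+ 2 + 1))// ?lerDl//.
  by rewrite ler_peMl ?addr_ge0// ler1n.
exists (1 + m.+1 ^ 2 * c)%N => R p h s a b G pp a1 b1 ah G0 KS.
have a0 : 0 <= a by apply: le_trans a1.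
have {}IH := IH R p h s a b G pp a1 b1 ah G0.
have {}IH : (@product_count 'F_p m h s)%:R * b ^+ 2
  <= c%:R * G%:R * (b ^+ 2 * a ^+ (4 * m) + a ^+ (8 * m - 2)).
  by apply: IH => j /andP[j0 jm]; apply: KS; rewrite j0 ltnW.
have b2 : 0 <= b ^+ 2 by rewrite exprn_ge0// (le_trans _ b1).
have := @product_count_step p m h s pp; rewrite -(ler_nat R) => /(ler_wpM2r b2) /le_trans;
  apply.
rewrite natrD mulrDl natrD mulrDl mulrDl mul1r lerD ?KS ?leqnn//.
set K := product_count m h s in IH *; set q := (m.+1 ^ 2)%N.
have -> : (q * (h * K))%N%:R * b ^+ 2 = q%:R * (a ^+ 4 * (K%:R * b ^+ 2)).
  by rewrite 2!natrM -ah -!mulrA.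
rewrite [(q * c)%N%:R]natrM -(mulrA q%:R c%:R) -(mulrA q%:R) ler_wpM2l//.
apply: le_trans (ler_wpM2l (exprn_ge0 4 a0) IH) _.
rewrite mulrCA ler_wpM2l ?mulr_ge0// mulrDr lerD//.
  by rewrite mulrCA -exprD mulnS.
by rewrite -exprD ler_weXn2l//; lia.
Qed.

Lemma monomial_count_bound (m : nat) (e : 'I_m -> int) : (0 < m)%N -> (forall i, e i != 0) ->
  exists c : nat, forall (R : realFieldType) p h (s : 'I_m -> 'F_p) (a b : R) (G : nat),
  prime p -> 1 <= a -> 1 <= b -> a ^+ 4 = h%:R -> (0 < G)%N ->
  (forall (t : 'F_p) j, (0 < j <= m)%N ->
    (disjoint_count j h t)%:R * b ^+ 2 <= G%:R * (b ^+ 2 * a ^+ (4 * j) + a ^+ (8 * j - 2))) ->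
  (@monomial_count 'F_p m h s e)%:R * b ^+ 2 <= c%:R * G%:R * (b ^+ 2 * a ^+ (4 * m)
    + a ^+ (8 * m - 2)).
Proof.
move=> m0 e0; have [c cP] := product_count_bound m.
exists (\sum_i `|e i| * c)%N => R p h s a b G pp a1 b1 ah G0 KS.
have b2 : 0 <= b ^+ 2 by rewrite exprn_ge0// (le_trans _ b1).
apply: (@le_trans _ _ ((\sum_i `|e i| * @product_count 'F_p m h (s i))%N%:R * b ^+ 2)).
  rewrite ler_wpM2r// ler_nat (leq_trans (leq_pmull _ m0))//.
  rewrite (leq_trans (monomial_count_holder _ _ _ m0))//; apply: leq_sum => i _.
  exact: monomial_count_const.
rewrite !natr_sum !mulr_suml; apply: ler_sum => i _.
rewrite !natrM -(mulrA _ _ (b ^+ 2)) -(mulrA _ c%:R) -(mulrA _ (c%:R * _)) ler_wpM2l//.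
by apply: cP => // j; apply: KS.
Qed.

(** * Character sums *)

(** Lagrange's identity: twice the defect is the sum of the squares (a_i b_k - a_k b_i)^2. *)
Lemma sum_Cauchy_Schwarz (C : numFieldType) (I : finType) (a b : I -> C) :
  (forall i, 0 <= a i) -> (forall i, 0 <= b i) ->
  (\sum_i a i * b i) ^+ 2 <= (\sum_i a i ^+ 2) * (\sum_i b i ^+ 2).
Proof.
move=> a0 b0; rewrite -subr_ge0 -(@pmulr_rge0 _ 2)//.
have -> : 2 * ((\sum_i a i ^+ 2) * (\sum_i b i ^+ 2) - (\sum_i a i * b i) ^+ 2) =
    \sum_i \sum_k (a i * b k - a k * b i) ^+ 2.
  transitivity (\sum_i \sum_k (a i ^+ 2 * b k ^+ 2
    + b i ^+ 2 * a k ^+ 2 - 2 * ((a i * b i) * (a k * b k)))).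
    under [RHS]eq_bigr do rewrite sumrB big_split /= -!mulr_sumr.
    rewrite sumrB big_split /= -mulr_sumr -!mulr_suml.
    by ring.
  by apply: eq_bigr => i _; apply: eq_bigr => k _; ring.
apply: sumr_ge0 => i _; apply: sumr_ge0 => k _.
by rewrite real_exprn_even_ge0// rpredB// rpredM// ger0_real.
Qed.

Section Bilinear.
Variables (F : finFieldType) (C : numClosedFieldType) (chi : F -> C).
Hypotheses (chi1 : chi 1 = 1) (chiM : {morph chi : x y / x * y}) (chi0 : chi 0 = 0).
Hypothesis (chi_nt : exists2 x, x != 0 & chi x != 1).

Lemma norm_chi u : u != 0 -> `|chi u| = 1.
Proof.
move=> u0; have cu : chi u != 0.
  apply/eqP => c0; have := chiM u u^-1; rewrite divff// chi1 c0 mul0r.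
  by move/eqP; rewrite oner_eq0.
have q1 : (1 < #|F|)%N by exact: finNzRing_gt1.
have chiX k : chi (u ^+ k) = chi u ^+ k.
  by elim: k => [|k IH]; rewrite ?expr0// !exprS chiM IH.
have /(congr1 Num.norm) : chi u ^+ #|F| = chi u by rewrite -chiX expf_card.
rewrite normrX -(prednK (ltnW q1)) exprS -[X in _ = X -> _]mulr1.
have nz : `|chi u| != 0 by rewrite normr_eq0.
move=> /(mulfI nz)/eqP; rewrite pexpr_eq1//; first by move/eqP.
by rewrite -subn1 subn_gt0.
Qed.

Lemma sum_chi : \sum_u chi u = 0.
Proof.
have [x x0 cx] := chi_nt; have xI : injective ( *%R x) by exact: mulfI.
have : chi x * \sum_u chi u = \sum_u chi u.
  rewrite mulr_sumr [RHS](reindex_inj xI) /=; apply: eq_bigr => u _.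
  by rewrite chiM.
move/eqP; rewrite -subr_eq0 -{2}[\sum_u _]mul1r -mulrBl mulf_eq0 subr_eq0 (negPf cx) /=.
by move/eqP.
Qed.

Lemma conj_chi u : (chi u)^* = chi u^-1.
Proof.
have [->|u0] := eqVneq u 0; first by rewrite invr0 chi0 conjC0.
have cu : chi u != 0 by rewrite -normr_eq0 norm_chi ?oner_eq0.
apply: (mulfI cu); rewrite -chiM divff// chi1 -normCK norm_chi// expr1n.
by [].
Qed.

(** These are the entries of the Gram matrix p I - J. Off the diagonal, translation turns the
    product into chi(1 + d / u) with d = w - w', and 1 + d / u takes every value except 1 when u
    runs over the units. *)
Lemma chi_corr w w' :
  \sum_u chi (u + w) * (chi (u + w'))^* = (w == w')%:R * #|F|%:R - 1.
Proof.
have aI (t : F) : injective (fun u => u - t) by exact: addIr.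
rewrite (reindex_inj (aI w')) /=; under eq_bigr do rewrite subrK.
have [<-|ww'] := eqVneq w w'.
  under eq_bigr do rewrite subrK -normCK.
  rewrite (bigD1 0)//= chi0 normr0 expr0n add0r mul1r.
  under eq_bigr => u u0 do rewrite norm_chi// expr1n.
  rewrite sumr_const; apply/eqP; rewrite -subr_eq opprK natr1; apply/eqP; congr (_%:R).
  by rewrite (cardC1 (0 : F)) prednK// ltnW// finNzRing_gt1.
rewrite mul0r add0r; set d := w - w'.
have d0 : d != 0 by rewrite subr_eq0.
(* Since the inverse of 0 is 0, the added term at u = 0 is chi(1) = 1, compensated by - 1. *)
transitivity (\sum_u chi (1 + d * u^-1) - 1).
  rewrite (bigD1 0)//= [in RHS](bigD1 0)//= chi0 conjC0 mulr0 invr0 mulr0 addr0 chi1.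
  rewrite add0r [RHS]addrC addKr; apply: eq_bigr => u u0.
  rewrite conj_chi -chiM; congr (chi _).
  by rewrite /d; field.
have fI : injective (fun u => d * u^-1) by move=> x y /(mulfI d0)/invr_inj.
rewrite -(reindex_inj fI (P := xpredT) (F := fun y => chi (1 + y))) /=.
have sI : injective (fun y : F => 1 + y) by exact: addrI.
by rewrite -(reindex_inj sI (P := xpredT) (F := chi)) /= sum_chi sub0r.
Qed.

Lemma chi_convolution (g : F -> C) :
  \sum_u `|\sum_w g w * chi (u + w)| ^+ 2 <= #|F|%:R * \sum_w `|g w| ^+ 2.
Proof.
have -> : \sum_u `|\sum_w g w * chi (u + w)| ^+ 2 =
    #|F|%:R * (\sum_w `|g w| ^+ 2) - `|\sum_w g w| ^+ 2.
  transitivity (\sum_u \sum_w \sum_w' (g w * (g w')^*) * (chi (u + w) * (chi (u + w'))^*)).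
    apply: eq_bigr => u _; rewrite normCK rmorph_sum mulr_suml; apply: eq_bigr => w _.
    by rewrite mulr_sumr; apply: eq_bigr => w' _; rewrite rmorphM mulrACA.
  rewrite exchange_big /=.
  transitivity (\sum_w \sum_w' (g w * (g w')^*) * ((w == w')%:R * #|F|%:R - 1)).
    apply: eq_bigr => w _; rewrite exchange_big; apply: eq_bigr => w' _.
    by rewrite -mulr_sumr chi_corr.
  rewrite normCK rmorph_sum mulr_suml mulr_sumr -sumrB; apply: eq_bigr => w _.
  under eq_bigr do rewrite mulrBr mulr1.
  rewrite sumrB mulr_sumr; congr (_ - _).
  rewrite (bigD1 w)//= eqxx mul1r big1 ?addr0 => [|w' ww']; first by rewrite normCK mulrC.
  by rewrite eq_sym (negPf ww') mul0r mulr0.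
by rewrite gerBl exprn_ge0.
Qed.

(** With v = lam / w, chi(u v + lam) = chi(lam / w) chi(u + w). Cauchy-Schwarz over u and
    [chi_convolution] finish; at w = 0 the convention 1 / 0 = 0 gives v = 0, where [be] vanishes. *)
Lemma bilinear_bound (al be : F -> C) (lam : F) : lam != 0 -> be 0 = 0 ->
  `|\sum_u \sum_v al u * be v * chi (u * v + lam)| ^+ 2 <=
  #|F|%:R * (\sum_u `|al u| ^+ 2) * (\sum_v `|be v| ^+ 2).
Proof.
move=> l0 be0; have fI : injective (fun w => lam * w^-1) by move=> x y /(mulfI l0)/invr_inj.
pose g w := be (lam * w^-1) * chi (lam * w^-1).
have E u : \sum_v al u * be v * chi (u * v + lam) = al u * \sum_w g w * chi (u + w).
  rewrite (reindex_inj fI) /= mulr_sumr; apply: eq_bigr => w _; rewrite -!mulrA; congr (_ * _).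
  rewrite /g; have [->|w0] := eqVneq w 0; first by rewrite invr0 mulr0 be0 !mul0r.
  by rewrite -chiM; congr (_ * chi _); field.
under eq_bigr do rewrite E.
apply: (@le_trans _ _ ((\sum_u `|al u| * `|\sum_w g w * chi (u + w)|) ^+ 2)).
  have T0 : 0 <= \sum_u `|al u| * `|\sum_w g w * chi (u + w)|.
    by apply: sumr_ge0 => u _; rewrite mulr_ge0.
  rewrite lerXn2r ?nnegrE ?normr_ge0 ?T0//.
  by rewrite (le_trans (ler_norm_sum _ _ _))//; apply: ler_sum => u _; rewrite normrM.
apply: le_trans (sum_Cauchy_Schwarz _ _) _ => // .
have A0 : 0 <= \sum_u `|al u| ^+ 2 by apply: sumr_ge0 => u _; rewrite exprn_ge0.
rewrite [#|F|%:R * _]mulrC -mulrA ler_wpM2l//.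
apply: le_trans (chi_convolution g) _; rewrite ler_wpM2l//.
rewrite [X in _ <= X](reindex_inj fI); apply: ler_sum => w _ /=.
rewrite /g normrM exprMn; have [->|w0] := eqVneq w 0.
  by rewrite invr0 mulr0 be0 normr0 expr0n mul0r.
by rewrite norm_chi ?expr1n ?mulr1// mulf_neq0 ?invr_eq0.
Qed.

(** Grouping x and y by the values of P1 and P2 gives the bilinear form; the squared norm of the
    fibre sums is at most the number of coincidences of nonzero values. *)
Lemma bilinear_image_bound (T1 T2 : finType) (P1 : T1 -> F) (P2 : T2 -> F)
    (A : T1 -> C) (B : T2 -> C) (lam : F) : lam != 0 ->
  (forall x, `|A x| <= 1) -> (forall y, `|B y| <= 1) ->
  `|\sum_x \sum_y if (P1 x != 0) && (P2 y != 0) then A x * B y * chi (P1 x * P2 y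
    + lam) else 0| ^+ 2
   <= (#|F| * #|[pred z : T1 * T1 | (P1 z.1 == P1 z.2) && (P1 z.1 != 0)]| *
       #|[pred z : T2 * T2 | (P2 z.1 == P2 z.2) && (P2 z.1 != 0)]|)%:R.
Proof.
move=> l0 A1 B1.
pose fib (T : finType) (P : T -> F) (a : T -> C) u := \sum_(x | (P x == u) && (P x != 0)) a x.
have fibE (T : finType) (P : T -> F) (a : T -> C) : (forall x, `|a x| <= 1) ->
    \sum_u `|fib T P a u| ^+ 2 <= (#|[pred z : T * T | (P z.1 == P z.2) && (P z.1 != 0)]|)%:R.
  move=> a1; apply: (@le_trans _ _ (\sum_u (\sum_(x | (P x == u) && (P x != 0)) 1) ^+ 2)).
    apply: ler_sum => u _; rewrite lerXn2r ?nnegrE ?normr_ge0 ?sumr_ge0//.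
    by rewrite (le_trans (ler_norm_sum _ _ _))//; apply: ler_sum.
  rewrite card_sumb natr_sum.
  rewrite -(pair_big xpredT xpredT (fun x y => ((P x == P y) && (P x != 0))%:R)) /=.
  under eq_bigr do rewrite expr2 mulr_suml.
  rewrite (exchange_big_dep (fun x => P x != 0)) /=; last by move=> u x _ /andP[].
  rewrite big_mkcond; apply: ler_sum => x _; case: ifP => [Px|_]; last exact: sumr_ge0.
  rewrite (big_pred1 (P x)) => [|u]; last by rewrite /= Px andbT eq_sym.
  rewrite mul1r big_mkcond; apply: ler_sum => y _; rewrite eq_sym.
  by case: eqP => [<-|_] /=; rewrite ?Px// mulr1n.
have -> : \sum_x \sum_y (if (P1 x != 0) && (P2 y != 0) then A x * B y * chi (P1 x * P2 y
  + lam) else 0) =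
    \sum_u \sum_v fib _ P1 A u * fib _ P2 B v * chi (u * v + lam).
  transitivity (\sum_u \sum_(x | P1 x == u) \sum_v \sum_(y | P2 y == v)
     if (P1 x != 0) && (P2 y != 0) then A x * B y * chi (u * v + lam) else 0).
    rewrite (partition_big P1 xpredT)//=; apply: eq_bigr => u _; apply: eq_bigr => x /eqP xu.
    rewrite (partition_big P2 xpredT)//=; apply: eq_bigr => v _; apply: eq_bigr => y /eqP yv.
    by rewrite xu yv.
  apply: eq_bigr => u _; rewrite exchange_big; apply: eq_bigr => v _.
  rewrite /fib mulr_suml mulr_suml big_mkcondr; apply: eq_bigr => x _.
  case: ifP => Px /=; last by rewrite big1.
  rewrite mulr_sumr mulr_suml big_mkcondr; apply: eq_bigr => y _.
  by case: ifP.
apply: le_trans (bilinear_bound _ l0 _) _.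
  by rewrite /fib big1// => y /andP[/eqP ->]; rewrite eqxx.
have fib0 (T : finType) (P : T -> F) a : 0 <= \sum_u `|fib T P a u| ^+ 2.
  by apply: sumr_ge0 => u _; rewrite exprn_ge0.
by rewrite !natrM ler_pM ?mulr_ge0 ?fib0 ?fibE// ler_wpM2l ?fibE.
Qed.
End Bilinear.

(** * Asymptotics of the exceptional set, sums over cubes and the final estimate *)

Local Open Scope classical_set_scope.
Local Open Scope complex_scope.

Lemma exceptional_littleo (R : realType) (n : nat) : (0 < n)%N ->
  (fun T : nat => (size (exceptional_seq n T))%:R : R^o) =o_\oo
  (fun T : nat => T%:R / ln T%:R : R^o).
Proof.
move=> n0; have [C C0 CP] := count_exceptional n0.
apply/eqoP => eps e0.
(* The count is at most C T / l^2 and ln T <= 2 l, so l >= 2 C / eps suffices; T >= 2^(N+1) ensures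
   l > N. *)
have [N NP] : exists N : nat, 2 * C%:R / eps <= N%:R.
  by exists (Num.truncn (2 * C%:R / eps)).+1; rewrite ltW// truncnS_gt.
exists (2 ^ N.+1)%N => // T /= NT.
have T2 : (2 <= T)%N by rewrite (leq_trans _ NT)// -[X in (X <= _)%N]expn1 leq_exp2l.
have := CP T T2; set l := trunc_log 2 T => E.
have lN : (N < l)%N by apply: trunc_log_max.
have Tl : (T < 2 ^ l.+1)%N by exact: trunc_log_ltn.
have T0 : 0 < T%:R :> R by rewrite ltr0n (leq_trans _ T2).
have l0 : 0 < l%:R :> R by rewrite ltr0n (leq_ltn_trans _ lN).
have lnT : ln (T%:R : R) <= 2 * l%:R.
  apply: (@le_trans _ _ (ln ((2 : R) ^+ l.+1))).
    by rewrite ler_ln ?posrE ?exprn_gt0// -natrX ler_nat ltnW.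
  rewrite lnXn// -[X in X <= _]mulr_natr.
  have ln2 : ln (2 : R) <= 1 by apply: (@le_ln1Dx R 1); lra.
  apply: (le_trans (ler_wpM2r (ler0n _ _) ln2)); rewrite mul1r.
  have : (1 : R) <= l%:R by rewrite ler1n (leq_ltn_trans _ lN).
  by rewrite -natr1; lra.
have lnT0 : 0 < ln (T%:R : R) by rewrite ln_gt0// ltr1n.
have nn : 0 <= T%:R / ln T%:R :> R by apply: divr_ge0; apply: ltW.
rewrite (ger0_norm nn) (ger0_norm (ler0n R _)).
have E' : (size (exceptional_seq n T))%:R * (l%:R : R) ^+ 2 <= C%:R * T%:R.
  by rewrite -natrX -!natrM ler_nat.
rewrite mulrA ler_pdivlMr//.
apply: (@le_trans _ _ ((size (exceptional_seq n T))%:R * (2 * l%:R))).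
  by rewrite ler_wpM2l.
rewrite -(@ler_pM2r _ l%:R)//.
have -> : (size (exceptional_seq n T))%:R * (2 * l%:R) * l%:R = 2 * ((size (exceptional_seq n T))%:R * (l%:R : R) ^+ 2).
  by rewrite expr2; ring.
have : 2 * C%:R <= eps * l%:R.
  by rewrite [eps * _]mulrC -ler_pdivrMr// (le_trans NP)// ler_nat ltnW.
move=> /(ler_wpM2r (ltW T0)) h; apply: (@le_trans _ _ (eps * l%:R * T%:R)).
  by apply: le_trans h; rewrite -mulrA ler_wpM2l.
by rewrite mulrAC.
Qed.

Lemma Fp_intr_eq0 p (x : int) : prime p -> ((p%:Z %| x)%Z) = (x%:~R == 0 :> 'F_p).
Proof. by move=> pp; apply: dvdz_pcharf; rewrite pchar_Fp. Qed.

Lemma fsum_finType (A : nmodType) (I : finType) (P : pred I) (f : I -> A) :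
  \sum_(x \in [set` P]) f x = \sum_(x | P x) f x.
Proof.
rewrite -(@bigfs _ _ _ _ (index_enum I)) ?index_enum_uniq// => x _.
by rewrite mem_index_enum.
Qed.

(** Coordinates are written k_j + 1 + x_j with 0 <= x_j < h, which puts the shifts k_j + 1 into
    [monomial]. Since all e_j are nonzero, the product of coordinates is prime to p exactly when the
    monomial is nonzero. *)
Lemma charsum_box (R : realType) (p n h : nat) (lambda : int) (chi : 'F_p -> R[i])
    (rho : 'I_n -> R -> R[i]) (e : 'I_n -> int) (k : 'I_n -> int) :
  prime p -> (h <= p)%N -> (forall j, e j != 0) ->
  let s j : 'F_p := (k j + 1)%:~R in
  charsum lambda chi rho e (cube k h) =
  \sum_(x : {ffun 'I_n -> 'I_h}) if monomial s e x != 0 then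
    (\prod_j rho j (k j + 1 + (x j : nat)%:Z)%:~R) * chi (monomial s e x + lambda%:~R) else 0.
Proof.
move=> pp hp e0 s; pose g (x : {ffun 'I_n -> 'I_h}) : {ffun 'I_n -> int} :=
  [ffun j => k j + 1 + (x j : nat)%:Z].
have gE x : \prod_(j < n) ((g x j)%:~R : 'F_p) ^ e j = monomial s e x.
  by apply: eq_bigr => j _; rewrite ffunE rmorphD /=.
have nzE x : (~~ (p%:Z %| \prod_(j < n) g x j)%Z) = (monomial s e x != 0).
  rewrite Fp_intr_eq0// -gE rmorph_prod; congr (~~ _).
  by rewrite !prodf_seq_eq0; apply: eq_has => j /=; rewrite expfz_eq0 e0.
rewrite /charsum -big_mkcond /=.
rewrite (reindex_fsbig g [set` [pred x | monomial s e x != 0]]); last first.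
  split.
  - move=> x /= xs; split; last by rewrite nzE.
    move=> j; rewrite ffunE; move: (nat_of_ord (x j)) (ltn_ord (x j)) (k j) => a ah b.
    by apply/andP; split; lia.
  - move=> x y _ _ /ffunP E; apply/ffunP => j; have := E j; rewrite !ffunE.
    by move=> /addrI [] /val_inj.
  move=> y [/= yB ynz].
  have yk j : k j + 1 <= y j /\ y j <= k j + h%:Z by apply/andP; exact: yB.
  have xP j : (absz (y j - k j - 1)%R < h)%N.
    by have [] := yk j; move: (y j) (k j) => u v; lia.
  have gy : g [ffun j => Ordinal (xP j)] = y.
    apply/ffunP => j; rewrite !ffunE /=; have [] := yk j.
    by move: (y j) (k j) => u v; lia.
  by exists [ffun j => Ordinal (xP j)]; rewrite /= ?inE -?nzE gy.
rewrite fsum_finType.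
apply: eq_bigr => x _; rewrite gE; congr (_ * _); apply: eq_bigr => j _.
by rewrite ffunE.
Qed.

Definition join_ffun m r h (x : {ffun 'I_m -> 'I_h}) (y : {ffun 'I_r -> 'I_h}) :
    {ffun 'I_(m + r) -> 'I_h} :=
  [ffun i => match fintype.split i with inl a => x a | inr b => y b end].

Lemma join_ffunl m r h (x : {ffun 'I_m -> 'I_h}) (y : {ffun 'I_r -> 'I_h}) i :
  join_ffun x y (lshift r i) = x i.
Proof. by rewrite ffunE -[lshift r i]/(unsplit (inl i)) unsplitK. Qed.

Lemma join_ffunr m r h (x : {ffun 'I_m -> 'I_h}) (y : {ffun 'I_r -> 'I_h}) i :
  join_ffun x y (rshift m i) = y i.
Proof. by rewrite ffunE -[rshift m i]/(unsplit (inr i)) unsplitK. Qed.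

Lemma sum_join (A : nmodType) m r h (f : {ffun 'I_(m + r) -> 'I_h} -> A) :
  \sum_x f x = \sum_(x : {ffun 'I_m -> 'I_h}) \sum_(y : {ffun 'I_r -> 'I_h}) f (join_ffun x y).
Proof.
rewrite pair_big /= (reindex (fun z : {ffun 'I_m -> 'I_h} * {ffun 'I_r -> 'I_h}
  => join_ffun z.1 z.2))//=.
exists (fun x => ([ffun i => x (lshift r i)], [ffun i => x (rshift m i)])) => [[x y] _|x _] /=.
  by congr (_, _); apply/ffunP => i; rewrite ffunE ?join_ffunl ?join_ffunr.
by apply/ffunP => i; rewrite ffunE; case: split_ordP => j ->; rewrite ffunE.
Qed.

Lemma monomial_join (F : finFieldType) m r h (s : 'I_(m + r) -> F) (e : 'I_(m + r) -> int)
    (x : {ffun 'I_m -> 'I_h}) (y : {ffun 'I_r -> 'I_h}) :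
  monomial s e (join_ffun x y) =
  monomial (fun i => s (lshift r i)) (fun i => e (lshift r i)) x *
  monomial (fun i => s (rshift m i)) (fun i => e (rshift m i)) y.
Proof.
rewrite /monomial big_split_ord /=; congr (_ * _); apply: eq_bigr => i _.
  by rewrite join_ffunl.
by rewrite join_ffunr.
Qed.

Lemma charsum_sqr_bound (R : realType) (p m r h : nat) (lambda : int) (chi : 'F_p -> R[i])
    (rho : 'I_(m + r) -> R -> R[i]) (e : 'I_(m + r) -> int) (k : 'I_(m + r) -> int) :
  prime p -> (h <= p)%N -> (forall j, e j != 0) ->
  (forall j x, `|rho j x| <= 1) -> mul_char chi -> nontrivial_char chi -> coprimez lambda p ->
  exists (s1 : 'I_m -> 'F_p) (s2 : 'I_r -> 'F_p),
  `|charsum lambda chi rho e (cube k h)| ^+ 2 <=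
  (p * monomial_count h s1 (fun i => e (lshift r i)) * monomial_count h s2 (fun i
    => e (rshift m i)))%:R.
Proof.
move=> pp hp e0 rho1 [[chi1 chiM] chi0] chi_nt col.
pose s j : 'F_p := (k j + 1)%:~R.
exists (fun i => s (lshift r i)), (fun i => s (rshift m i)).
have l0 : lambda%:~R != 0 :> 'F_p.
  rewrite -Fp_intr_eq0// dvdzE /= -prime_coprime//.
  by rewrite coprime_sym.
have A1 (I : finType) (f : I -> R[i]) : (forall i, `|f i| <= 1) -> `|\prod_i f i| <= 1.
  move=> f1; elim/big_rec: _ => [|i y _ IH]; first by rewrite normr1.
  by rewrite normrM mulr_ile1 ?normr_ge0.
have := @bilinear_image_bound 'F_p R[i] chi chi1 chiM chi0 chi_nt _ _
  (fun x : {ffun 'I_m -> 'I_h} => monomial (fun i => s (lshift r i)) (fun i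
    => e (lshift r i)) x)
  (fun x : {ffun 'I_r -> 'I_h} => monomial (fun i => s (rshift m i)) (fun i
    => e (rshift m i)) x)
  (fun x => \prod_i rho (lshift r i) (k (lshift r i) + 1 + (x i : nat)%:Z)%:~R)
  (fun x => \prod_i rho (rshift m i) (k (rshift m i) + 1 + (x i : nat)%:Z)%:~R)
  lambda%:~R l0.
move=> /(_ (fun x => A1 _ _ (fun i => rho1 _ _)) (fun x => A1 _ _ (fun i => rho1 _ _))).
rewrite card_Fp// -/(monomial_count _ _ _) -/(monomial_count _ _ _); apply: le_trans.
rewrite (charsum_box _ _ _ _ pp hp e0) sum_join le_eqVlt; apply/orP; left; apply/eqP.
congr (`|_| ^+ 2); apply: eq_bigr => x _; apply: eq_bigr => y _.
rewrite monomial_join.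
rewrite mulf_eq0 negb_or; case: ifP => // _; congr (_ * _).
rewrite big_split_ord /=; congr (_ * _); apply: eq_bigr => i _.
  by rewrite join_ffunl.
by rewrite join_ffunr.
Qed.

Lemma two_factor_bound (R : realFieldType) (a b : R) (m r : nat) : 1 <= a -> 1 <= b ->
  (0 < m <= r)%N ->
  (b ^+ 2 * a ^+ (4 * m) + a ^+ (8 * m - 2)) * (b ^+ 2 * a ^+ (4 * r) + a ^+ (8 * r - 2)) <=
  2 * (b ^+ 2 * a ^+ (2 * (m + r)) + b * a ^+ (2 * (m + r) + 2 * r - 1) +
     a ^+ (4 * (m + r) - 2)) ^+ 2.
Proof.
move=> a1 b1 /andP[m0 mr]; have a0 : 0 <= a by apply: le_trans a1.
have b0 : 0 <= b by apply: le_trans b1.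
have eX : (b ^+ 2 * a ^+ (2 * (m + r))) ^+ 2 = b ^+ 2 * a ^+ (4 * m) * (b ^+ 2 * a ^+ (4 * r)).
  by rewrite mulrACA -!exprD exprMn -!exprM; congr (_ ^+ _ * _ ^+ _); lia.
have eY : (b * a ^+ (2 * (m + r) + 2 * r - 1)) ^+ 2 = b ^+ 2 * a ^+ (4 * m) * a ^+ (8 * r - 2).
  by rewrite -mulrA -exprD exprMn -exprM; congr (_ * _ ^+ _); lia.
have eZ : (a ^+ (4 * (m + r) - 2)) ^+ 2 = a ^+ (8 * m - 2) * a ^+ (8 * r - 2).
  by rewrite -exprD -exprM; congr (_ ^+ _); lia.
have le : a ^+ (8 * m - 2) * (b ^+ 2 * a ^+ (4 * r))
  <= b ^+ 2 * a ^+ (4 * m) * a ^+ (8 * r - 2).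
  rewrite mulrCA -mulrA -!exprD ler_wpM2l ?exprn_ge0// ler_weXn2l//; lia.
set X := b ^+ 2 * a ^+ (2 * (m + r)) in eX *.
set Y := b * _ in eY *; set Z := a ^+ (4 * (m + r) - 2) in eZ *.
have X0 : 0 <= X by rewrite mulr_ge0 ?exprn_ge0.
have Y0 : 0 <= Y by rewrite mulr_ge0 ?exprn_ge0.
have Z0 : 0 <= Z by rewrite exprn_ge0.
have XY : 0 <= X * Y by rewrite mulr_ge0.
have XZ : 0 <= X * Z by rewrite mulr_ge0.
have YZ : 0 <= Y * Z by rewrite mulr_ge0.
apply: (@le_trans _ _ (X ^+ 2 + 2 * Y ^+ 2 + Z ^+ 2)); first by rewrite eX eY eZ; lra.
have X2 : 0 <= X ^+ 2 by rewrite exprn_ge0.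
have Z2 : 0 <= Z ^+ 2 by rewrite exprn_ge0.
by rewrite [(X + Y + Z) ^+ 2](_ : _ = X ^+ 2 + Y ^+ 2 + Z ^+ 2 + 2 * (X * Y)
  + 2 * (X * Z) + 2 * (Y * Z)); [lra|ring].
Qed.

(** Take k > 1 / eps in [threshold_pow]; then the threshold is at most (2 C h)^(1/k) <= 2 C
    h^eps. *)
Lemma threshold_le_powR (R : realType) (n : nat) (eps : R) : (0 < n)%N -> 0 < eps ->
  exists2 C : R, 0 < C & forall h i : nat, (0 < h)%N -> (2 ^ i < 2 * h)%N ->
  (threshold n i)%:R <= C * h%:R `^ eps.
Proof.
move=> n0 e0; pose k := (Num.truncn (1 / eps)).+1.
have ke : (k%:R : R)^-1 <= eps.
  by rewrite -(invrK eps) lef_pV2 ?posrE ?invr_gt0// -div1r ltW// truncnS_gt.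
have k0 : k%:R != 0 :> R by rewrite pnatr_eq0.
have [C C0 CP] := @threshold_pow n k n0 isT.
have C2 : 1 <= (2 * C)%N%:R :> R by rewrite ler1n muln_gt0 C0.
exists (2 * C)%N%:R => [|h i h0 ih]; first by rewrite ltr0n muln_gt0 C0.
have k1 : (k%:R : R)^-1 <= 1 by rewrite invf_le1 ?ltr0n// ler1n.
have h1 : 1 <= h%:R :> R by rewrite ler1n.
have -> : (threshold n i)%:R = ((threshold n i ^ k)%N%:R : R) `^ (k%:R)^-1.
  by rewrite natrX -powR_mulrn// -powRrM divff// powRr1.
apply: (@le_trans _ _ (((2 * C)%N%:R * h%:R) `^ (k%:R)^-1)).
  apply: ge0_ler_powR; rewrite ?nnegrE ?invr_ge0// ?mulr_ge0//.
  rewrite -natrM ler_nat (leq_trans (CP i))//.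
  by rewrite [(2 * C)%N]mulnC -mulnA leq_mul2l (ltnW ih) orbT.
rewrite powRM//; apply: ler_pM; rewrite ?powR_ge0//; first exact: ler1_powR.
exact: ler_powR.
Qed.

Theorem theorem9 (R : realType) (n : nat) (hn : (2 <= n)%N) :
  exists E : nat -> {fset nat},
    (forall T : nat, (2 <= T)%N ->
       forall p : nat, p \in E T -> prime p /\ (p <= T)%N) /\
    ((fun T : nat => (#|` E T|%fset)%:R : R^o) =o_\oo
       (fun T : nat => T%:R / ln T%:R : R^o)) /\
    (forall e : 'I_n -> int, \prod_(j < n) e j != 0 ->
     forall eps : R, 0 < eps ->
     exists2 C : R, 0 < C &
     exists T0 : nat, forall T : nat, (T0 <= T)%N -> (2 <= T)%N ->
     forall p : nat, prime p -> (p <= T)%N -> p \notin E T ->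
     forall h : nat, (3 <= h <= p)%N ->
     forall (k : 'I_n -> int) (rho : 'I_n -> R -> R[i]),
     (forall (j : 'I_n) (x : R), `|rho j x| <= 1) ->
     forall chi : 'F_p -> R[i], mul_char chi -> nontrivial_char chi ->
     forall lambda : int, coprimez lambda p ->
     `|charsum lambda chi rho e (cube k h)| <=
       (C * (h%:R `^ (n%:R / 2) * p%:R `^ (1 / 2)
             + h%:R `^ (n%:R / 2 + (uphalf n)%:R / 2 - 1 / 4) * p%:R `^ (1 / 4)
             + h%:R `^ (n%:R - 1 / 2))
          * h%:R `^ eps)%:C).
Proof.
have n0 : (0 < n)%N by apply: leq_trans hn.
exists (fun T => seq_fset tt (exceptional_seq n T)); split=> [T T2 p|].
  by rewrite seq_fsetE mem_filter mem_iota add0n ltnS => /andP[/andP[-> _]].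
split.
  under eq_fun do rewrite size_seq_fset undup_id ?filter_uniq ?iota_uniq//.
  exact: exceptional_littleo.
move=> e e0 eps eps0; have [Cg Cg0 CgP] := threshold_le_powR n0 eps0.
have ej j : e j != 0 by move/prodf_neq0: e0; apply.
have [m [r [En Er m0 mr]]] : exists m r, [/\ n = (m + r)%N, uphalf n = r, (0 < m)%N & (m
  <= r)%N].
  by exists n./2, (uphalf n); split=> //; lia.
rewrite Er; subst n.
have r0 : (0 < r)%N by apply: leq_trans mr.
have [c1 c1P] := monomial_count_bound m0 (fun i => ej (lshift r i)).
have [c2 c2P] := monomial_count_bound r0 (fun i => ej (rshift m i)).
have D0 : 0 < 2 * (c1 * c2 + 1)%N%:R * (4 ^ (m + r))%N%:R :> R.
  by rewrite !mulr_gt0// ltr0n ?addn_gt0 ?orbT// expn_gt0.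
(* The first factor bounds the square root of 2 c1 c2, 4^n comes from [disjoint_count_not_bad], and
   [Cg] from the threshold. *)
exists (2 * (c1 * c2 + 1)%N%:R * (4 ^ (m + r))%N%:R * Cg); first exact: mulr_gt0.
exists 0%N => T _ T2 p pp pT pE h /andP[h3 hp] k rho rho1 chi chiM chi_nt lambda col.
have h0 : (0 < h)%N by apply: leq_trans h3.
have h1 : (1 < h)%N by apply: leq_trans h3.
pose i := up_log 2 h; pose a : R := h%:R `^ (1 / 4); pose b : R := p%:R `^ (1 / 4).
have /andP[ih hi] : (2 ^ i.-1 < h <= 2 ^ i)%N by exact: up_log_bounds.
have i0 : (0 < i)%N by rewrite up_log_gt0.
have ih2 : (2 ^ i < 2 * h)%N by rewrite -(prednK i0) expnS ltn_mul2l.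
have a1 : 1 <= a by rewrite -(@powRr0 R h%:R) ler_powR ?ler1n// divr_ge0.
have b1 : 1 <= b by rewrite -(@powRr0 R p%:R) ler_powR ?ler1n ?prime_gt0// divr_ge0.
have hX q : a ^+ q = h%:R `^ (q%:R / 4).
  by rewrite -powR_mulrn ?powR_ge0// -powRrM mul1r mulrC.
have pX q : b ^+ q = p%:R `^ (q%:R / 4).
  by rewrite -powR_mulrn ?powR_ge0// -powRrM mul1r mulrC.
have ah : a ^+ 4 = h%:R by rewrite hX divff ?powRr1// pnatr_eq0.
have bp : b ^+ 4 = p%:R by rewrite pX divff ?powRr1// pnatr_eq0.
(* As h <= p <= T, the scale i of h is among those tested by [exceptional]. *)
have lT : (i <= (trunc_log 2 T).+1)%N.
  apply: up_log_min => //; apply: ltnW; apply: leq_ltn_trans (trunc_log_ltn T _) => //.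
  exact: leq_trans pT.
have nbad j : (0 < j <= m + r)%N -> ~~ bad (m + r) i j p.
  move=> /andP[j0 jn]; apply: contra pE => bj.
  rewrite seq_fsetE mem_filter mem_iota add0n ltnS pT leq0n /exceptional pp /= ?andbT.
  apply/existsP; exists (Ordinal (jn : (j < (m + r).+1)%N)).
  apply/existsP; exists (Ordinal (lT : (i < (trunc_log 2 T).+2)%N)).
  by rewrite /= j0.
set G := (threshold (m + r) i * 4 ^ (m + r))%N.
have G0 : (0 < G)%N
  by rewrite muln_gt0 expn_gt0 andbT (leq_trans _ (threshold_ge i n0))// expn_gt0.
have b0 : 0 <= b by rewrite powR_ge0.
have a0 : 0 <= a by rewrite powR_ge0.
have KS (t : 'F_p) j : (0 < j <= m + r)%N ->
    (disjoint_count j h t)%:R * b ^+ 2 <= G%:R * (b ^+ 2 * a ^+ (4 * j) + a ^+ (8 * j - 2)).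
  move=> jn; have /andP[j0 jn'] := jn.
  apply: le_trans (disjoint_count_not_bad t j0 a1 b0 ah bp hp hi ih2 (nbad _ jn)) _.
  rewrite ler_wpM2r ?addr_ge0 ?mulr_ge0 ?exprn_ge0// ler_nat.
  by rewrite leq_mul2l leq_exp2l ?jn' ?orbT.
have GE : G = (threshold (m + r) i * 4 ^ (m + r))%N by [].
clearbody G; have [s1 [s2 S]] := charsum_sqr_bound k pp hp ej rho1 chiM chi_nt col.
set J1 := monomial_count _ _ _ in S; set J2 := monomial_count _ _ _ in S.
have B1 : J1%:R * b ^+ 2 <= c1%:R * G%:R * (b ^+ 2 * a ^+ (4 * m) + a ^+ (8 * m - 2)).
  by apply: c1P => // t j /andP[j0 jm]; apply: KS; rewrite j0 (leq_trans jm)// leq_addr.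
have B2 : J2%:R * b ^+ 2 <= c2%:R * G%:R * (b ^+ 2 * a ^+ (4 * r) + a ^+ (8 * r - 2)).
  by apply: c2P => // t j /andP[j0 jm]; apply: KS; rewrite j0 (leq_trans jm)// leq_addl.
pose W := b ^+ 2 * a ^+ (2 * (m + r)) + b * a ^+ (2 * (m + r) + 2 * r - 1) + a ^+ (4 * (m
  + r) - 2).
have W0 : 0 <= W by rewrite !addr_ge0 ?mulr_ge0 ?exprn_ge0.
(* The three terms of the estimate are the monomials in a = h^(1/4) and b = p^(1/4) of
   [two_factor_bound]. *)
have -> : h%:R `^ ((m + r)%N%:R / 2) * p%:R `^ (1 / 2)
             + h%:R `^ ((m + r)%N%:R / 2 + r%:R / 2 - 1 / 4) * p%:R `^ (1 / 4)
             + h%:R `^ ((m + r)%N%:R - 1 / 2) = W.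
  rewrite /W !hX pX [b * _]mulrC [_ `^ (2%:R / 4) * _]mulrC; congr (_ `^ _ * _ `^ _
    + _ `^ _ * _ + _ `^ _).
  - by rewrite natrM; lra.
  - by lra.
  - by rewrite natrB ?natrD ?natrM ?natrD; [lra|rewrite addn_gt0 !muln_gt0 addn_gt0 m0].
  by rewrite natrB ?natrM; [lra|rewrite (leq_trans _ (leq_pmulr 4 n0))].
set X := _ * W * _; have X0 : 0 <= X.
  by rewrite mulr_ge0 ?powR_ge0// mulr_ge0//; apply/ltW/mulr_gt0.
suff N : (p * J1 * J2)%N%:R <= X ^+ 2.
  have X0c : 0 <= X%:C by rewrite -[0]/(0%:C) lecR.
  rewrite -(@ler_pXn2r _ 2)// ?nnegrE ?normr_ge0//; apply: le_trans S _.
  by rewrite -(rmorph_nat (real_complex R)) -rmorphXn lecR.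
apply: (@le_trans _ _ ((2 * (c1 * c2 + 1)%N%:R * G%:R * W) ^+ 2)); last first.
  have Y0 : 0 <= 2 * (c1 * c2 + 1)%N%:R * G%:R * W by rewrite mulr_ge0// !mulr_ge0.
  rewrite lerXn2r ?nnegrE//.
  rewrite /X GE natrM; set q := (4 ^ _)%N%:R; set c := (_ + 1)%N%:R.
  have := CgP h i h0 ih2; set g := (threshold _ _)%:R => gC.
  rewrite (_ : 2 * c * (g * q) * W = 2 * c * q * W * g); last by ring.
  rewrite (_ : 2 * c * q * Cg * W * _ = 2 * c * q * W * (Cg * h%:R `^ eps)); last by ring.
  by rewrite ler_wpM2l// !mulr_ge0.
(* The factor p = b^4 is shared out as b^2 to each count, the form in which [B1] and [B2] bound
   them. *)
rewrite !natrM -bp (_ : b ^+ 4 * J1%:R * J2%:R = (J1%:R * b ^+ 2) * (J2%:R * b ^+ 2));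
  last by ring.
apply: le_trans (ler_pM _ _ B1 B2) _; rewrite ?mulr_ge0 ?exprn_ge0//.
rewrite mulrACA.
apply: le_trans (ler_wpM2l _ (two_factor_bound a1 b1 (_ : (0 < m <= r)%N))) _;
  rewrite ?m0 ?mr ?mulr_ge0//.
rewrite -/W (_ : (c1 * c2 + 1)%N%:R = c1%:R * c2%:R + 1); last by rewrite natrD natrM.
set x1 := c1%:R; set x2 := c2%:R; set g := G%:R.
have x12 : 0 <= x1 * x2 by rewrite mulr_ge0.
rewrite (_ : x1 * g * (x2 * g) * (2 * W ^+ 2) = 2 * (x1 * x2) * (g * W) ^+ 2); last by ring.
rewrite (_ : (2 * (x1 * x2 + 1) * g * W) ^+ 2 = 4 * (x1 * x2 + 1) ^+ 2 * (g * W) ^+ 2);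
  last by ring.
rewrite ler_wpM2r ?exprn_ge0 ?mulr_ge0//.
by nra.
Qed.
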